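(* Let $a,b\ge 0$ be two given numbers and let $$\Gamma_{a,b}:=\Big\{\gamma\in L^1_{per}(0,2\pi):\ \int_0^{2\pi}\gamma_+(t)\,dt=a,\ \int_0^{2\pi}\gamma_-(t)\,dt=b\Big\}.$$ For $\gamma\in\Gamma_{a,b}$ let $\mu_+(\gamma)$ and $\mu_-(\gamma)$ be the maximal and the minimal Lyapunov exponents, respectively, of the scalar linear equation $$y''(t)+\gamma(t)y'(t)+y(t)=0 .$$ Then $$\sup_{\gamma\in\Gamma_{a,b}}\mu_+(\gamma)=\frac{b}{2\pi},\qquad \inf_{\gamma\in\Gamma_{a,b}}\mu_-(\gamma)=-\frac{a}{2\pi}.$$
   Context: $L^1_{per}(0,2\pi)$ is the space of real-valued $2\pi$-periodic functions on $\mathbb R$ that are integrable over a period. $\gamma_+:=\max\{\gamma,0\}$, $\gamma_-:=\gamma_+-\gamma\ge0$. The equation is viewed as a first-order linear $2\pi$-periodic system for $(y,y')$. Its Lyapunov exponents are $\frac1{2\pi}\ln|\rho_1|$ and $\frac1{2\pi}\ln|\rho_2|$, where $\rho_1,\rho_2$ are the eigenvalues (Floquet multipliers) of the period map $(y(0),y'(0))\mapsto(y(2\pi),y'(2\pi))$; $\mu_+$ is the larger and $\mu_-$ the smaller of these two numbers. *)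

(* Defs.v *)
From HB Require Import structures.
From mathcomp Require Import all_boot all_order all_algebra.
From mathcomp Require Import all_classical all_reals all_analysis.
From mathcomp.real_closed Require Import complex.
Set Implicit Arguments.
Unset Strict Implicit.
Unset Printing Implicit Defensive.
Import Order.TTheory GRing.Theory Num.Theory.
Import numFieldNormedType.Exports.

Local Open Scope classical_set_scope.
Local Open Scope ring_scope.

Definition abs_continuous_on (R : realType) (s t : R) (f : R -> R) : Prop :=
  forall e : R, 0 < e -> exists2 d : R, 0 < d &
    forall (n : nat) (u v : 'I_n -> R),
      (forall i, [/\ s <= u i, u i <= v i & v i <= t]) ->
      trivIset [set: 'I_n] (fun i => [set` `]u i, v i[]) ->
      \sum_(i < n) (v i - u i) < d ->
      \sum_(i < n) `|f (v i) - f (u i)| < e.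

Definition L1_per (R : realType) (gamma : R -> R) : Prop :=
  (forall t, gamma (t + 2 * pi) = gamma t) /\
  lebesgue_measure.-integrable `[0, 2 * pi] (EFin \o gamma).

Definition Gamma (R : realType) (a b : R) : set (R -> R) :=
  [set gamma | [/\ L1_per gamma,
    (\int[lebesgue_measure]_(t in `[0%R, (2 * pi)%R]) (gamma^\+ t)%R%:E = a%:E)%E
  & (\int[lebesgue_measure]_(t in `[0%R, (2 * pi)%R]) (gamma^\- t)%R%:E = b%:E)%E]].

(* Caratheodory solution over one period of y' = v, v' = - gamma v - y, the
   first-order system of y'' + gamma y' + y = 0. *)
Definition solution (R : realType) (gamma y v : R -> R) : Prop :=
  [/\ abs_continuous_on 0 (2 * pi) y,
      abs_continuous_on 0 (2 * pi) v,
      {ae lebesgue_measure, forall t : R, t \in `[0, 2 * pi] ->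
         is_derive t 1 y (v t)}
    & {ae lebesgue_measure, forall t : R, t \in `[0, 2 * pi] ->
         is_derive t 1 v (- gamma t * v t - y t)}].

Definition state (R : realType) (y v : R -> R) (t : R) : 'rV[R]_2 :=
  \row_(j < 2) (if j == 0 then y t else v t).

(* For integrable gamma there is exactly one solution with a given initial
   state, so the set below is a singleton and the default 0 is not used. *)
Definition period_map (R : realType) (gamma : R -> R) (x0 : 'rV[R]_2)
    : 'rV[R]_2 :=
  xget 0 [set x1 | exists y v : R -> R,
    [/\ solution gamma y v, state y v 0 = x0 & state y v (2 * pi) = x1]].

Definition monodromy (R : realType) (gamma : R -> R) : 'M[R]_2 :=
  lin1_mx (period_map gamma).

(* The two complex roots of the (monic, quadratic) characteristic polynomial,
   listed with multiplicity. *)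
Definition floquet_multipliers (R : realType) (gamma : R -> R) : seq R[i] :=
  sval (closed_field_poly_normal
          (char_poly (map_mx (real_complex R) (monodromy gamma)))).

Definition lyapunov_exponent (R : realType) (gamma : R -> R) (k : nat) : R :=
  ln (ComplexField.Normc.normc (floquet_multipliers gamma)`_k) / (2 * pi).

Definition mu_plus (R : realType) (gamma : R -> R) : R :=
  Num.max (lyapunov_exponent gamma 0) (lyapunov_exponent gamma 1).

Definition mu_minus (R : realType) (gamma : R -> R) : R :=
  Num.min (lyapunov_exponent gamma 0) (lyapunov_exponent gamma 1).

(* Main.v *)
Require Import Defs.
From mathcomp Require Import all_boot all_order all_algebra.
From mathcomp Require Import all_classical all_reals all_analysis.
From mathcomp Require Import ring lra.
From mathcomp.real_closed Require Import complex.
Import Order.TTheory GRing.Theory Num.Theory.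
Import numFieldNormedType.Exports.
Local Open Scope classical_set_scope.
Local Open Scope ring_scope.

(** Along a solution the energy [y ^+ 2 + v ^+ 2], with [v = y'], has derivative
    [- 2 * gamma * v ^+ 2], which lies between [- 2 * gamma_+] and
    [2 * gamma_-] times the energy. Over a period the norm of the state is
    therefore multiplied by a factor between [expR (- a)] and [expR b]
    ([monodromy_energy]). Applied to the real and imaginary parts of an
    eigenvector, this bounds the modulus of every Floquet multiplier by the same
    two numbers ([multiplier_bounds]), hence the exponents by [- a / (2 * pi)] and
    [b / (2 * pi)].

    The bounds are approached by concentrating the friction. A negative kick of
    total mass [b] at a time when [y] is zero multiplies [v], and so the whole
    state, by about [expR b]. A quarter period of the free rotation later [v] is
    zero, and a positive kick of mass [a] has almost no effect on that solution,
    while it damps the complementary one by about [expR (- a)]. For kicks of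
    length [h] the trace of the monodromy matrix is at least
    [expR b + expR (- a) - K * h] ([kicked_trace]), and by Liouville's formula its
    determinant is exactly [expR (b - a)] ([monodromy_det]). Two numbers with this
    product and almost this sum are close to [expR b] and [expR (- a)]
    ([root_separation]), so one family of coefficients serves for the supremum
    and for the infimum ([extremal_family]).

    As [gamma] is merely integrable, solutions are absolutely continuous and
    solve the equation almost everywhere. Every estimate on them rests on one
    fact: an absolutely continuous function whose derivative is nonnegative
    almost everywhere is nondecreasing ([abs_continuous_ae_nondecreasing]). It
    gives Gronwall's inequality, hence the energy bounds and uniqueness.
    Existence ([solution_exists]) follows from Picard iteration after the change
    of unknown [v = expR (- G) * w], with [G] a primitive of [gamma], which makes
    the coefficients continuous. *)

Set Implicit Arguments.
Unset Strict Implicit.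
Unset Printing Implicit Defensive.

(** * Real induction and almost everywhere statements *)

Section RealInduction.
Context {R : realType}.
Notation mu := (@lebesgue_measure R).
Implicit Types (f g h : R -> R) (s t : R).

Lemma is_derive_bound f (x d : R) : is_derive x 1 f d ->
  forall e, 0 < e -> exists2 r, 0 < r &
    forall y, `|y - x| < r -> `|f y - f x - d * (y - x)| <= e * `|y - x|.
Proof.
move=> fd e e0.
have df : derivable f x 1 by case: fd.
have : h^-1 *: (f (h *: 1 + x) - f x) @[h --> 0^'] --> d.
  by have -> : d = 'D_1 f x by [rewrite derive_val]; exact: df.
move=> /cvgrPdist_le /(_ _ e0) /=.
move=> -[r /= r0 H]; exists r => // y yx.
have [->|xy] := eqVneq y x; first by rewrite !subrr mulr0 subrr normr0 mulr0.
have yx0 : y - x != 0 by rewrite subr_eq0.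
have := H (y - x); rewrite /= sub0r normrN => /(_ yx yx0).
rewrite /GRing.scale/= mulr1 subrK => {}H.
have -> : f y - f x - d * (y - x) =
  - (d - (y - x)^-1 * (f y - f x)) * (y - x) by field.
by rewrite normrM normrN ler_wpM2r.
Qed.

(** Continuous induction, in the role that Cousin's lemma on tagged partitions
    plays for gauge integrals: the set of [x] with [P s x] contains its
    supremum by locality at that point, and locality also pushes it beyond. *)
Lemma interval_induction (P : R -> R -> Prop) s t : s <= t ->
  (forall u v w, s <= u -> u <= v -> v <= w -> w <= t ->
     P u v -> P v w -> P u w) ->
  (forall x, s <= x -> x <= t -> exists2 d, 0 < d & forall u v,
     s <= u -> u <= x -> x <= v -> v <= t -> x - d < u -> v < x + d -> P u v) ->
  P s t.
Proof.
move=> st Padd Ploc.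
pose S := [set x | [/\ s <= x, x <= t & P s x]].
have Ss : S s.
  split=> //; have [d d0] := Ploc s (lexx _) st; apply => //; lra.
have ubS : ubound S t by move=> x [].
have supS : has_sup S by split; [exists s | exists t].
have cs : s <= sup S by apply: ub_le_sup => //; exists t.
have ct : sup S <= t by apply: ge_sup => //; exists s.
have [d d0 Pd] := Ploc _ cs ct.
have [x [sx xt Px] cx] := sup_adherent d0 supS.
have xc : x <= sup S by apply: ub_le_sup => //; exists t.
pose v := Num.min t (sup S + d / 2).
have vt : v <= t by rewrite /v ge_min lexx.
have cv : sup S <= v by rewrite /v le_min ct /=; lra.
have vd : v < sup S + d by rewrite /v gt_min; apply/orP; right; lra.
have Pv : P s v.
  apply: (Padd _ x) => //; first exact: le_trans cv.
  exact: Pd.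
have Sv : S v by split => //; exact: le_trans cv.
have : v <= sup S by apply: ub_le_sup => //; exists t.
rewrite /v ge_min => /orP[tc|]; last by move=> ?; exfalso; lra.
have -> : t = v; last by [].
apply/eqP; rewrite eq_le vt andbT /v le_min lexx /=; lra.
Qed.

Lemma ae_neq (c : R) : {ae mu, forall x, x <> c}.
Proof.
exists [set c]; split => //; first by rewrite lebesgue_measure_set1.
by move=> x /= /contrapT.
Qed.

Lemma ae_imp (P Q : R -> Prop) : {ae mu, forall x, P x} ->
  (forall x, P x -> Q x) -> {ae mu, forall x, Q x}.
Proof.
by move=> aeP PQ; apply: filterS aeP => //; exact: (ae_filter_ringOfSetsType mu).
Qed.

Lemma ae_and (P Q : R -> Prop) : {ae mu, forall x, P x} ->
  {ae mu, forall x, Q x} -> {ae mu, forall x, P x /\ Q x}.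
Proof.
by move=> aeP aeQ; apply: filterI aeP aeQ => //; exact: (ae_filter_ringOfSetsType mu).
Qed.

End RealInduction.

(** * Monotonicity from the sign of an almost everywhere derivative *)

Section Monotonicity.
Context {R : realType}.
Notation mu := (@lebesgue_measure R).
Implicit Types (f g h : R -> R) (s t : R).

Lemma trivIset_ord_cat m n (A : 'I_m -> set R) (B : 'I_n -> set R) :
  trivIset setT A -> trivIset setT B ->
  (forall i j, A i `&` B j = set0) ->
  trivIset setT (fun k => match fintype.split k with inl i => A i | inr j => B j end).
Proof.
move=> tA tB AB k l _ _.
case: (fintype.splitP k) => i ki; case: (fintype.splitP l) => j lj => H.
- have e := tA i j I I H; apply: val_inj; rewrite /= ki lj; by rewrite e.
- by move: H; rewrite AB => -[].
- by move: H; rewrite setIC AB => -[].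
- have e := tB i j I I H; apply: val_inj; rewrite /= ki lj; by rewrite e.
Qed.

(** [U] stands for an open set around the points without a good derivative. The
    two error terms have different origins: [e * (v - u)] comes from the points
    with a nonnegative derivative, the sum from intervals inside [U], which
    absolute continuity controls as soon as [U] has small measure. Both are
    additive in the interval. *)
Definition drop_bound f (U : set R) e (u v : R) :=
  exists n (a b : 'I_n -> R),
  [/\ forall i, [/\ u <= a i, a i <= b i & b i <= v],
      trivIset [set: 'I_n] (fun i => [set` `]a i, b i[]),
      forall i, [set` `]a i, b i[] `<=` U &
      f u - f v <= e * (v - u) + \sum_(i < n) `|f (b i) - f (a i)|].

Lemma drop_bound_cat f U e (u v w : R) : u <= v -> v <= w ->
  drop_bound f U e u v -> drop_bound f U e v w -> drop_bound f U e u w.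
Proof.
move=> uv vw [m [a [b [abuv tab abU fuv]]]] [n [c [d [cdvw tcd cdU fvw]]]].
pose j T (x : 'I_m -> T) (y : 'I_n -> T) (k : 'I_(m + n)) :=
  match fintype.split k with inl i => x i | inr j => y j end.
exists (m + n)%N, (j _ a c), (j _ b d); split.
- move=> k; rewrite /j; case: (fintype.split k) => i.
    by have [? ? ?] := abuv i; split => //; exact: le_trans vw.
  by have [? ? ?] := cdvw i; split => //; exact: le_trans uv _.
- rewrite (_ : (fun i => _) = j _ (fun i => [set` `]a i, b i[])
      (fun i => [set` `]c i, d i[])); last first.
    by apply/funext => k; rewrite /j; case: (fintype.split k).
  apply: trivIset_ord_cat => // i k; apply/seteqP; split => // x [] /=.
  rewrite !in_itv/= => /andP[_ xb] /andP[cx _].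
  have [_ _ bv] := abuv i; have [vc _ _] := cdvw k.
  by have := lt_trans cx xb; rewrite ltNge (le_trans bv vc).
- by move=> k; rewrite /j; case: (fintype.split k).
- rewrite big_split_ord /=.
  under eq_bigr do rewrite /j (unsplitK (inl _)).
  under [X in _ <= _ + (_ + X)]eq_bigr do rewrite /j (unsplitK (inr _)).
  lra.
Qed.

Lemma lebesgue_measure_disjoint_itv n (a b : 'I_n -> R) :
  (forall i, a i <= b i) -> trivIset [set: 'I_n] (fun i => [set` `]a i, b i[]) ->
  mu (\big[setU/set0]_(i < n) [set` `]a i, b i[]) = (\sum_(i < n) (b i - a i))%:E.
Proof.
move=> ab tab.
have -> : ((\sum_(i < n) (b i - a i))%:E = \sum_(i < n) mu [set` `]a i, b i[])%E.
  rewrite -sumEFin; apply: eq_bigr => i _; rewrite lebesgue_measure_itv /= lte_fin.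
  case: ltP => // ba; have -> : a i = b i by apply/eqP; rewrite eq_le ab ba.
  by rewrite subrr.
rewrite -measure_semi_additive_ord //.
by apply: bigsetU_measurable => i _; exact: measurable_itv.
Qed.

Lemma sum_length_lt n (a b : 'I_n -> R) (U : set R) (d : R) :
  (forall i, a i <= b i) -> trivIset [set: 'I_n] (fun i => [set` `]a i, b i[]) ->
  (forall i, [set` `]a i, b i[] `<=` U) -> measurable U ->
  (mu U < d%:E)%E -> \sum_(i < n) (b i - a i) < d.
Proof.
move=> ab tab abU mU Ud; rewrite -lte_fin; apply: le_lt_trans Ud.
rewrite -lebesgue_measure_disjoint_itv//; apply: le_measure; rewrite ?inE//.
  by apply: bigsetU_measurable => i _; exact: measurable_itv.
apply: (big_ind (fun A => A `<=` U)) => // A B AU BU.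
by rewrite subUset.
Qed.

(** A point with a nonnegative derivative lets [f] drop by at most [e] times the
    length near that point; an exceptional point has a neighbourhood inside an
    open set [U] of measure below the modulus of absolute continuity. Real
    induction glues these local bounds, so the total drop is at most
    [e * (t - s) + e]. *)
Lemma abs_continuous_ae_nondecreasing f s t : s <= t ->
  abs_continuous_on s t f ->
  {ae mu, forall x : R, s < x -> x < t -> exists2 d : R, is_derive x 1 f d & 0 <= d} ->
  f s <= f t.
Proof.
move=> st acf aef.
rewrite -subr_le0; apply/ler_addgt0Pr => e' e'0; rewrite add0r.
have ts0 : 0 < t - s + 1 by lra.
pose e := e' / (t - s + 1).
have e0 : 0 < e by rewrite divr_gt0.
suff : f s - f t <= e * (t - s) + e.
  by have -> : e * (t - s) + e = e' by rewrite /e; field; rewrite gt_eqF.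
have [d d0 acd] := acf e e0.
have [N [mN N0 subN]] : {ae mu, forall x : R, [/\ x <> s, x <> t &
    s < x -> x < t -> exists2 d : R, is_derive x 1 f d & 0 <= d]}.
  by apply: (ae_imp (ae_and (ae_and (ae_neq s) (ae_neq t)) aef)) => x [[]]; split.
have Nfin : (mu N < +oo)%E by move: N0 => /= ->; exact: ltry.
have [U [oU NU UN]] := lebesgue_regularity_outer mN Nfin d0.
have Ud : (mu U < d%:E)%E.
  have -> : U = (U `\` N) `|` N by rewrite setUC setDUK.
  rewrite measureU0//; apply: measurableD => //.
  exact: measurable_realfun.open_measurable.
have good x : ~ U x -> [/\ s < x -> x < t -> exists2 d : R, is_derive x 1 f d & 0 <= d,
   x <> s & x <> t].
  move=> nUx; apply: contrapT => H; apply: nUx; apply/NU/subN => -[xs xt fx].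
  by apply: H.
have : drop_bound f U e s t.
  apply: interval_induction => //.
    by move=> u v w su uv vw wt; exact: drop_bound_cat.
  move=> x sx xt; have [Ux|/good[fx /eqP xs /eqP nxt]] := pselect (U x).
    have [r /= r0 rU] : nbhs x U by apply: open_nbhs_nbhs; split.
    exists r => // u v su ux xv vt ru vr.
    exists 1%N, (fun=> u), (fun=> v); split.
    - by move=> _; split => //; exact: le_trans xv.
    - by move=> i j _ _ _; rewrite (ord1 i) (ord1 j).
    - move=> _ z /=; rewrite in_itv/= => /andP[uz zv]; apply: rU.
      by rewrite /ball /= ltr_norml; apply/andP; split; lra.
    - rewrite big_ord1 distrC; apply: (le_trans (ler_norm _)).
      by rewrite lerDr; apply: mulr_ge0; [exact: ltW|lra].
  have [||c fc c0] := fx.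
  - by rewrite lt_neqAle sx eq_sym xs.
  - by rewrite lt_neqAle xt nxt.
  have [r r0 H] := is_derive_bound fc e0.
  exists r => // u v su ux xv vt ru vr.
  exists 0%N, (fun=> 0), (fun=> 0); split; try by case.
  rewrite big_ord0 addr0.
  have := H u; have := H v.
  rewrite (ger0_norm (_ : 0 <= v - x)) ?subr_ge0//.
  rewrite (ler0_norm (_ : u - x <= 0)) ?subr_le0// opprB.
  rewrite !ler_norml => /(_ ltac:(lra))/andP[A _] /(_ ltac:(lra))/andP[_ B].
  have C1 : 0 <= c * (v - x) by rewrite mulr_ge0 ?subr_ge0.
  have C2 : 0 <= c * (x - u) by rewrite mulr_ge0 ?subr_ge0.
  lra.
move=> [n [a [b [abst tab abU fst]]]].
apply: (le_trans fst); rewrite lerD2l ltW//; apply: acd => //.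
apply: (sum_length_lt (U := U)) => //; last exact: measurable_realfun.open_measurable.
by move=> i; have [] := abst i.
Qed.

End Monotonicity.

(** * Calculus of absolutely continuous functions *)

Section AbsoluteContinuity.
Context {R : realType}.
Notation mu := (@lebesgue_measure R).
Implicit Types (f g h : R -> R) (s t : R).

(** A single criterion that yields the stability under sums, products and
    exponentials: each of these operations is Lipschitz on bounded sets. *)
Lemma abs_continuous_dominated g h K f s t : 0 <= K ->
  abs_continuous_on s t g -> abs_continuous_on s t h ->
  (forall u v, s <= u -> u <= v -> v <= t ->
     `|f v - f u| <= K * (`|g v - g u| + `|h v - h u|)) ->
  abs_continuous_on s t f.
Proof.
move=> K0 acg ach fgh e e0.
have K1 : 0 < 2 * (K + 1) by lra.
have e1 : 0 < e / (2 * (K + 1)) by rewrite divr_gt0.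
have [d1 d10 G] := acg _ e1; have [d2 d20 H] := ach _ e1.
exists (Num.min d1 d2); first by rewrite lt_min d10.
move=> n u v uv tuv; rewrite lt_min => /andP[/(G _ _ _ uv tuv) Gn /(H _ _ _ uv tuv) Hn].
apply: (@le_lt_trans _ _ (\sum_(i < n) K * (`|g (v i) - g (u i)| + `|h (v i) - h (u i)|))).
  by apply: ler_sum => i _; have [? ? ?] := uv i; exact: fgh.
rewrite -mulr_sumr big_split/=.
set a := \sum_(i < n) `|g _ - _| in Gn *; set b := \sum_(i < n) _ in Hn *.
have a0 : 0 <= a by exact: sumr_ge0.
have b0 : 0 <= b by exact: sumr_ge0.
have -> : e = (K + 1) * (e / (2 * (K + 1)) + e / (2 * (K + 1))).
  by field; rewrite gt_eqF//; lra.
apply: (@le_lt_trans _ _ ((K + 1) * (a + b))).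
  by apply: ler_wpM2r; lra.
by rewrite ltr_pM2l; lra.
Qed.

Lemma abs_continuous_id s t : abs_continuous_on s t id.
Proof.
move=> e e0; exists e => // n u v uv _; apply: le_lt_trans.
by apply: ler_sum => i _; have [_ ? _] := uv i; rewrite ger0_norm// subr_ge0.
Qed.

Lemma abs_continuous_lipschitz K f s t : 0 <= K ->
  (forall u v, s <= u -> u <= v -> v <= t -> `|f v - f u| <= K * (v - u)) ->
  abs_continuous_on s t f.
Proof.
move=> K0 fK; apply: (abs_continuous_dominated K0 (@abs_continuous_id s t)
  (@abs_continuous_id s t)).
move=> u v su uv vt; apply: le_trans (fK _ _ su uv vt) _.
by apply: ler_wpM2l => //=; rewrite ger0_norm ?subr_ge0//; lra.
Qed.

Lemma abs_continuous_cst c s t : abs_continuous_on s t (cst c).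
Proof.
by apply: (@abs_continuous_lipschitz 0) => // *; rewrite subrr normr0 mul0r.
Qed.

Lemma abs_continuousD f g s t : abs_continuous_on s t f ->
  abs_continuous_on s t g -> abs_continuous_on s t (fun x => f x + g x).
Proof.
move=> acf acg; apply: (abs_continuous_dominated ler01 acf acg) => u v *.
rewrite mul1r; apply: le_trans (ler_normD _ _).
have -> : f v + g v - (f u + g u) = f v - f u + (g v - g u) by ring.
exact: lexx.
Qed.

Lemma abs_continuousN f s t : abs_continuous_on s t f ->
  abs_continuous_on s t (fun x => - f x).
Proof.
move=> acf; apply: (abs_continuous_dominated ler01 acf acf) => u v *.
by rewrite mul1r -opprD normrN lerDl.
Qed.

Lemma abs_continuousB f g s t : abs_continuous_on s t f ->
  abs_continuous_on s t g -> abs_continuous_on s t (fun x => f x - g x).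
Proof. by move=> acf acg; apply: abs_continuousD => //; exact: abs_continuousN. Qed.

Lemma abs_continuous_subitv s' t' f s t : s <= s' -> t' <= t ->
  abs_continuous_on s t f -> abs_continuous_on s' t' f.
Proof.
move=> ss tt acf e /acf[d d0 H]; exists d => // n u v uv; apply: H => i.
by have [? ? ?] := uv i; split => //; [exact: le_trans ss _|exact: le_trans tt].
Qed.

Lemma abs_continuous_uniform f s t : abs_continuous_on s t f ->
  forall e, 0 < e -> exists2 d, 0 < d & forall u v, s <= u -> u <= t ->
    s <= v -> v <= t -> `|v - u| < d -> `|f v - f u| < e.
Proof.
move=> acf e /acf[d d0 H]; exists d => //.
have {}H u v : s <= u -> u <= v -> v <= t -> v - u < d -> `|f v - f u| < e.
  move=> su uv vt uvd; have := H 1%N (fun=> u) (fun=> v).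
  rewrite !big_ord1; apply => //.
  by move=> i j _ _ _; rewrite (ord1 i) (ord1 j).
move=> u v su ut sv vt; have [uv|/ltW vu] := leP u v.
  by rewrite ger0_norm ?subr_ge0//; exact: H.
by rewrite distrC ger0_norm ?subr_ge0// distrC; exact: H.
Qed.

Lemma abs_continuous_bounded f s t : abs_continuous_on s t f ->
  exists2 M, 0 <= M & forall x, s <= x -> x <= t -> `|f x| <= M.
Proof.
move=> acf; have [st|ts] := leP s t; last first.
  exists 0 => // x sx xt; exfalso; lra.
apply: (interval_induction (P := fun u v => exists2 M, 0 <= M &
  forall x, u <= x -> x <= v -> `|f x| <= M) st).
  move=> u v w _ uv vw _ [M M0 HM] [N N0 HN]; exists (M + N); first lra.
  move=> x ux xw; have [xv|/ltW vx] := leP x v.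
    by apply: le_trans (HM _ ux xv) _; lra.
  by apply: le_trans (HN _ vx xw) _; lra.
have [d d0 H] := abs_continuous_uniform acf ltr01.
move=> x sx xt; exists d => // u v su ux xv vt du vd.
exists (1 + `|f x|); first by have := normr_ge0 (f x); lra.
move=> z uz zv; have zx : `|z - x| < d by rewrite ltr_norml; apply/andP; split; lra.
have := H x z sx xt ltac:(lra) ltac:(lra) zx.
have : `|f z| <= `|f z - f x| + `|f x| by rewrite -{1}(subrK (f x) (f z)) ler_normD.
lra.
Qed.

Lemma abs_continuousM f g s t : abs_continuous_on s t f ->
  abs_continuous_on s t g -> abs_continuous_on s t (fun x => f x * g x).
Proof.
move=> acf acg.
have [M M0 fM] := abs_continuous_bounded acf.
have [N N0 gN] := abs_continuous_bounded acg.
apply: (abs_continuous_dominated (addr_ge0 M0 N0) acf acg) => u v su uv vt.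
have -> : f v * g v - f u * g u = f v * (g v - g u) + g u * (f v - f u) by ring.
apply: le_trans (ler_normD _ _) _; rewrite !normrM.
have fv : `|f v| <= M by apply: fM; lra.
have gu : `|g u| <= N by apply: gN; lra.
have := normr_ge0 (g v - g u); have := normr_ge0 (f v - f u).
set a := `|f v - f u|; set b := `|g v - g u| => a0 b0.
have := ler_wpM2r b0 fv; have := ler_wpM2r a0 gu.
have := mulr_ge0 M0 a0; have := mulr_ge0 N0 b0; lra.
Qed.

Lemma abs_continuous_expR f s t : abs_continuous_on s t f ->
  abs_continuous_on s t (fun x => expR (f x)).
Proof.
move=> acf; have [M M0 fM] := abs_continuous_bounded acf.
apply: (abs_continuous_dominated (expR_ge0 M) acf acf) => u v su uv vt.
have expB a b : a <= b -> b <= M -> `|expR b - expR a| <= expR M * (b - a).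
  move=> ab bM; rewrite ger0_norm ?subr_ge0 ?ler_expR//.
  have -> : expR b - expR a = expR b * (1 - expR (a - b)).
    by rewrite mulrBr mulr1 -expRD; congr (_ - expR _); ring.
  apply: ler_pM; rewrite ?expR_ge0 ?ler_expR ?subr_ge0//.
    by rewrite -expR0 ler_expR; lra.
  by have := expR_ge1Dx (a - b); lra.
have fvM : f v <= M by apply: le_trans (ler_norm _) (fM _ _ _); lra.
have fuM : f u <= M by apply: le_trans (ler_norm _) (fM _ _ _); lra.
have E0 := mulr_ge0 (expR_ge0 M) (normr_ge0 (f v - f u)).
suff : `|expR (f v) - expR (f u)| <= expR M * `|f v - f u| by lra.
have [fuv|/ltW fvu] := leP (f u) (f v).
  by rewrite (ger0_norm (_ : 0 <= f v - f u)) ?subr_ge0//; exact: expB.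
rewrite distrC (distrC (f v)) (ger0_norm (_ : 0 <= f u - f v)) ?subr_ge0//.
exact: expB.
Qed.

End AbsoluteContinuity.

(** * Primitives of integrable functions *)

Section Primitives.
Context {R : realType}.
Notation mu := (@lebesgue_measure R).
Implicit Types (f g h : R -> R) (s t : R).

Lemma is_derive_derive1 f (x d : R) : derivable f x 1 -> derive1 f x = d -> is_derive x 1 f d.
Proof. by move=> df <-; rewrite derive1E; exact: DeriveDef. Qed.

(** The increments over disjoint intervals add up to at most the integral of
    [`|f|] over their union, a set of small measure. *)
Lemma integral_abs_continuous f s t : mu.-integrable setT (EFin \o f) ->
  abs_continuous_on s t (fun x => \int[mu]_(y in `]-oo, x]) f y).
Proof.
move=> intf e e0.
have [d [d0 H]] := integral_normr_continuous intf e0.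
have intS A : measurable A -> mu.-integrable A (EFin \o f).
  by move=> mA; apply: integrableS intf.
have intaS A : measurable A -> mu.-integrable A (EFin \o (fun x => `|f x|)).
  by move=> mA; have := integrable_abse (intS A mA).
exists d => // n u v uv tuv uvd.
pose U := \big[setU/set0]_(i < n) [set` `]u i, v i[].
have mU : measurable U by apply: bigsetU_measurable => i _; exact: measurable_itv.
have Ud : (mu U < d%:E)%E.
  by rewrite lebesgue_measure_disjoint_itv// => i; have [] := uv i.
apply: le_lt_trans (H U mU Ud).
have -> : \int[mu]_(x in U) `|f x| = \sum_(i < n) \int[mu]_(x in `]u i, v i[) `|f x|.
  rewrite /Rintegral integral_bigsetU_EFin//.
  - rewrite sum_fine// => i _; apply: integrable_fin_num => //.
    exact: intaS.
  - by rewrite /index_enum -enumT enum_uniq.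
  - by move=> i j _ _; exact: tuv.
  - by have /integrableP[] := intaS U mU.
apply: ler_sum => i _; have [_ uvi _] := uv i.
rewrite Rintegral_itvB ?bnd_simp//; last exact: intS.
rewrite -Rintegral_itv_bndo_bndc; last exact: intS.
by apply: le_normr_Rintegral => //; exact: intS.
Qed.

(** Lebesgue differentiation, applied to [g] extended by zero outside [[s, t]], so
    that the primitive is defined on both sides of every point of [[s, t]]. *)
Lemma L1_primitive g s t : s <= t -> mu.-integrable `[s, t] (EFin \o g) ->
  exists G, [/\ abs_continuous_on s t G,
    {ae mu, forall x : R, s <= x -> x <= t -> is_derive x 1 G (g x)},
    G s = 0 & G t = \int[mu]_(x in `[s, t]) g x].
Proof.
move=> st intg; pose f := g \_ `[s, t].
have intf : mu.-integrable setT (EFin \o f).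
  by rewrite /f -restrict_EFin; apply/integrable_restrict => //=; rewrite setTI.
exists (fun x => \int[mu]_(y in `]-oo, x]) f y); split.
- exact: integral_abs_continuous.
- have locf : locally_integrable setT f.
    by apply: open_integrable_locally => //; exact: openT.
  have intf' y : mu.-integrable `]-oo, y] (EFin \o f) by apply: integrableS intf.
  have H := FTC1Ny intf' locf.
  apply: (ae_imp H) => x [dF Fx] sx xt.
  apply: is_derive_derive1 => //; rewrite Fx /f patchE mem_set//=.
  by rewrite in_itv /= sx xt.
- rewrite /f -Rintegral_mkcondr (_ : _ `&` _ = [set s]) ?Rintegral_set1//.
  apply/seteqP; split => x /=; rewrite !in_itv/=.
    by move=> [xs /andP[sx _]]; apply/eqP; rewrite eq_le xs sx.
  by move=> ->; rewrite lexx.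
- rewrite /f -Rintegral_mkcondr; congr (Rintegral _ _ _).
  apply/seteqP; split => x /=; rewrite !in_itv/=; first by case.
  by move=> /[dup] H /andP[].
Qed.

(** Composition with the projection of the line onto [[s, t]] extends a function
    given on [[s, t]] to a continuous function on the line. *)
Definition clamp s t (x : R) : R := Num.max s (Num.min x t).

Lemma clamp_ge s t x : s <= clamp s t x.
Proof. by rewrite /clamp le_max lexx. Qed.

Lemma clamp_le s t x : s <= t -> clamp s t x <= t.
Proof. by move=> st; rewrite /clamp ge_max st ge_min lexx orbT. Qed.

Lemma clamp_id s t x : s <= x -> x <= t -> clamp s t x = x.
Proof. by move=> sx xt; rewrite /clamp (min_idPl xt) (max_idPr sx). Qed.

Lemma clamp_lipschitz s t x y : `|clamp s t y - clamp s t x| <= `|y - x|.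
Proof.
rewrite /clamp /Num.max /Num.min.
case: (ltP y t) => ?; case: (ltP x t) => ?; do ?[case: (ltP s) => ?];
  rewrite ler_norml; have := ler_norm (y - x); have := ler_norm (- (y - x));
  rewrite normrN => *; apply/andP; split; lra.
Qed.

Lemma abs_continuous_clamp f s t : s <= t -> abs_continuous_on s t f ->
  continuous (fun x => f (clamp s t x)).
Proof.
move=> st acf x; apply/cvgrPdist_lt => e e0.
have [d d0 H] := abs_continuous_uniform acf e0.
exists d => //= y xy; rewrite distrC; apply: H;
  rewrite ?clamp_ge ?clamp_le//.
by apply: le_lt_trans (clamp_lipschitz _ _ _ _) _; rewrite distrC.
Qed.

End Primitives.

(** * Derivatives, comparison and limits for the Picard iteration *)

Section Picard.
Context {R : realType}.
Notation mu := (@lebesgue_measure R).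
Implicit Types (f g h p r y w : R -> R) (s t : R).

Lemma is_derive_congr f (x a b : R) : is_derive x 1 f a -> a = b -> is_derive x 1 f b.
Proof. by move=> fa <-. Qed.

Lemma is_derive_add f g (x a b : R) : is_derive x 1 f a -> is_derive x 1 g b ->
  is_derive x 1 (fun z => f z + g z) (a + b).
Proof. by move=> fa gb; exact: is_deriveD. Qed.

Lemma is_derive_sub f g (x a b : R) : is_derive x 1 f a -> is_derive x 1 g b ->
  is_derive x 1 (fun z => f z - g z) (a - b).
Proof. by move=> fa gb; exact: is_deriveB. Qed.

Lemma is_derive_mul f g (x a b : R) : is_derive x 1 f a -> is_derive x 1 g b ->
  is_derive x 1 (fun z => f z * g z) (a * g x + f x * b).
Proof.
move=> fa gb; apply: is_derive_congr (is_deriveM fa gb) _.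
by rewrite /GRing.scale /=; ring.
Qed.

Lemma is_derive_scale f (c x a : R) : is_derive x 1 f a ->
  is_derive x 1 (fun z => c * f z) (c * a).
Proof.
move=> fa; apply: is_derive_congr (is_derive_mul (is_derive_cst c x 1) fa) _.
by rewrite mul0r add0r.
Qed.

Lemma is_derive_opp f (x a : R) : is_derive x 1 f a ->
  is_derive x 1 (fun z => - f z) (- a).
Proof. by move=> fa; exact: is_deriveN. Qed.

Lemma is_derive_exp f (x a : R) : is_derive x 1 f a ->
  is_derive x 1 (fun z => expR (f z)) (a * expR (f x)).
Proof.
move=> fa; rewrite mulrC.
exact: (is_derive1_comp (is_derive_expR _) fa).
Qed.

(** Continuity at [0] is required from both sides. The class is stable under
    [prim0] nevertheless, because [prim0 f] vanishes on the negative axis. *)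
Definition continuous_ge0 f := forall x : R, 0 <= x -> {for x, continuous f}.

Definition prim0 f (x : R) : R := \int[mu]_(t in `[0, x]) f t.

Lemma is_derive_continuous f (x d : R) : is_derive x 1 f d -> {for x, continuous f}.
Proof.
move=> fd; apply/differentiable_continuous/derivable1_diffP.
by case: fd.
Qed.

Lemma prim00 f : prim0 f 0 = 0.
Proof. by rewrite /prim0 set_itv1 Rintegral_set1. Qed.

Lemma continuous_ge0_integrable f u : continuous_ge0 f ->
  mu.-integrable `[0, u] (EFin \o f).
Proof.
move=> cf; apply: continuous_compact_integrable; first exact: segment_compact.
apply: continuous_in_subspaceT => x; rewrite inE/= in_itv/= => /andP[x0 _].
exact: cf.
Qed.

Lemma is_derive_prim0 f (x : R) : continuous_ge0 f -> 0 < x -> is_derive x 1 (prim0 f) (f x).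
Proof.
move=> cf x0; have x1 : x < x + 1 by lra.
have [dF Fx] := continuous_FTC1_closed x1
  (@continuous_ge0_integrable f (x + 1) cf) x0 (cf _ (ltW x0)).
exact: is_derive_derive1.
Qed.

Lemma continuous_prim0 f : continuous_ge0 f -> continuous_ge0 (prim0 f).
Proof.
move=> cf x; rewrite le_eqVlt => /predU1P[<-|x0].
  suff : prim0 f x @[x --> (0 : R)] --> prim0 f 0 by [].
  rewrite prim00.
  by apply: (parameterized_integral_cvg_left ltr01); exact: continuous_ge0_integrable.
exact: (is_derive_continuous (is_derive_prim0 cf x0)).
Qed.

Lemma continuous_ge0_cst c : continuous_ge0 (cst c).
Proof. by move=> x _; exact: cvg_cst. Qed.

Lemma continuous_ge0D f g : continuous_ge0 f -> continuous_ge0 g ->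
  continuous_ge0 (fun x => f x + g x).
Proof. by move=> cf cg x x0; apply: continuousD; [exact: cf|exact: cg]. Qed.

Lemma continuous_ge0B f g : continuous_ge0 f -> continuous_ge0 g ->
  continuous_ge0 (fun x => f x - g x).
Proof. by move=> cf cg x x0; apply: continuousB; [exact: cf|exact: cg]. Qed.

Lemma continuous_ge0M f g : continuous_ge0 f -> continuous_ge0 g ->
  continuous_ge0 (fun x => f x * g x).
Proof. by move=> cf cg x x0; apply: continuousM; [exact: cf|exact: cg]. Qed.

Lemma derive_nondecreasing f f' : continuous_ge0 f ->
  (forall x : R, 0 < x -> is_derive x 1 f (f' x)) ->
  (forall x : R, 0 < x -> 0 <= f' x) -> forall s t, 0 <= s -> s <= t -> f s <= f t.
Proof.
move=> cf df f'0 s t s0 st.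
have df' x : x \in `]s, t[ -> is_derive x 1 f (f' x).
  by rewrite in_itv/= => /andP[sx _]; apply: df; apply: le_lt_trans sx.
have cf' : {within `[s, t], continuous f}.
  apply: continuous_in_subspaceT => x; rewrite inE/= in_itv/= => /andP[x0 _].
  by apply: cf; exact: le_trans x0.
move: st; rewrite le_eqVlt => /predU1P[->//|st].
have [c + E] := MVT st df' cf'.
rewrite in_itv/= => /andP[sc ct].
rewrite -subr_ge0 E; apply: mulr_ge0; last by lra.
apply: f'0; lra.
Qed.

(** Monotonicity of [h - f] and of [h + f]. *)
Lemma derive_comparison f f' h h' : continuous_ge0 f -> continuous_ge0 h ->
  (forall x : R, 0 < x -> is_derive x 1 f (f' x)) ->
  (forall x : R, 0 < x -> is_derive x 1 h (h' x)) ->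
  `|f 0| <= h 0 -> (forall x : R, 0 < x -> `|f' x| <= h' x) ->
  forall x, 0 <= x -> `|f x| <= h x.
Proof.
move=> cf ch df dh fh0 fh x x0.
have A : h 0 - f 0 <= h x - f x.
  apply: (@derive_nondecreasing (fun x => h x - f x) (fun x => h' x - f' x)) => //.
  - exact: continuous_ge0B.
  - by move=> z z0; apply: is_deriveB; [exact: dh|exact: df].
  - by move=> z z0; have := ler_norm (f' z); have := fh z z0; lra.
have B : h 0 + f 0 <= h x + f x.
  apply: (@derive_nondecreasing (fun x => h x + f x) (fun x => h' x + f' x)) => //.
  - exact: continuous_ge0D.
  - by move=> z z0; apply: is_deriveD; [exact: dh|exact: df].
  - by move=> z z0; have := ler_norm (- f' z); rewrite normrN; have := fh z z0; lra.
move: fh0; rewrite !ler_norml => /andP[? ?]; apply/andP; split; lra.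
Qed.

Lemma is_derive_expRM (C k x : R) :
  is_derive x 1 (fun x => C * expR (k * x)) (C * (k * expR (k * x))).
Proof.
apply/is_derive_scale/is_derive_exp.
by apply: is_derive_congr (is_derive_scale k (is_derive_id x 1)) _; rewrite mulr1.
Qed.

(** The limit is the supremum of the nondecreasing sequence
    [u n - 2 * C * 2^-1 ^+ n], which is bounded by every member of the
    nonincreasing sequence [u n + 2 * C * 2^-1 ^+ n]. *)
Lemma geometric_increments_limit (u : nat -> R) C :
  (forall n, `|u n.+1 - u n| <= C * 2^-1 ^+ n) ->
  exists l, forall n, `|u n - l| <= 2 * C * 2^-1 ^+ n.
Proof.
move=> uC.
pose a n := u n - 2 * C * 2^-1 ^+ n; pose b n := u n + 2 * C * 2^-1 ^+ n.
have aS n : a n <= a n.+1.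
  have := uC n; rewrite ler_norml /a exprS => /andP[? ?]; lra.
have bS n : b n.+1 <= b n.
  have := uC n; rewrite ler_norml /b exprS => /andP[? ?]; lra.
have am : {homo a : m n / (m <= n)%N >-> m <= n} by apply: homo_leq => //; exact: le_trans.
have bm : {homo b : m n / (m <= n)%N >-> n <= m}.
  by apply: homo_leq => // z x y xz zy; exact: le_trans zy xz.
have C0 : 0 <= C by have := uC 0%N; rewrite expr0 mulr1; apply: le_trans.
have ab m n : a m <= b n.
  apply: (@le_trans _ _ (a (maxn m n))); first by apply: am; exact: leq_maxl.
  apply: (@le_trans _ _ (b (maxn m n))); last by apply: bm; exact: leq_maxr.
  rewrite /a /b.
  have : 0 <= C * 2^-1 ^+ maxn m n by rewrite mulr_ge0// exprn_ge0.
  lra.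
exists (sup (range a)) => n.
have al : a n <= sup (range a).
  by apply: ub_le_sup; [exists (b 0%N) => _ [m _ <-]|exists n].
have lb : sup (range a) <= b n.
  by apply: ge_sup; [exists (a 0%N), 0%N|move=> _ [m _ <-]].
rewrite ler_norml; apply/andP; split; rewrite /a /b in al lb; lra.
Qed.

Lemma half_expn_small (C e : R) : 0 < e -> exists n, C * 2^-1 ^+ n < e.
Proof.
move=> e0; have := @cvg_geometric R C (2^-1) _.
have -> : `|2^-1 : R| < 1 by rewrite ger0_norm; lra.
move=> /(_ isT)/cvgrPdist_lt/(_ _ e0)[n _ /(_ n (leqnn n))].
by rewrite /= sub0r normrN => H; exists n; apply: le_lt_trans H; exact: ler_norm.
Qed.

End Picard.

(** * Existence for linear systems with continuous coefficients *)

Section PicardIteration.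
Context {R : realType}.
Notation mu := (@lebesgue_measure R).
Variables (p r : R -> R) (K y0 w0 : R).
Hypotheses (cp : continuous_ge0 p) (cr : continuous_ge0 r).
Hypotheses (K0 : 0 < K) (pK : forall x, `|p x| <= K) (rK : forall x, `|r x| <= K).

Fixpoint picard n : (R -> R) * (R -> R) :=
  if n is m.+1 then
    (fun x => y0 + prim0 (fun t => p t * (picard m).2 t) x,
     fun x => w0 + prim0 (fun t => r t * (picard m).1 t) x)
  else (cst 0, cst 0).

Let M := `|y0| + `|w0|.
Let E (x : R) := expR ((2 * K) * x).

Let M0 : 0 <= M. Proof. by rewrite addr_ge0. Qed.

Lemma continuous_picard n :
  continuous_ge0 (picard n).1 /\ continuous_ge0 (picard n).2.
Proof.
elim: n => [|n [c1 c2]] /=; first by split; exact: continuous_ge0_cst.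
split; apply: continuous_ge0D; first exact: continuous_ge0_cst.
- by apply/continuous_prim0/continuous_ge0M.
- exact: continuous_ge0_cst.
- by apply/continuous_prim0/continuous_ge0M.
Qed.

(** The weight [E] makes the integral operator a contraction of ratio [1/2] on the
    whole half-line: [E] has derivative [2 * K * E], so integrating a function
    bounded by [K * (2 * C * E)] gives at most [C * E]. *)
Lemma prim0_contraction a (f g : R -> R) C : (forall x, `|a x| <= K) ->
  continuous_ge0 a -> continuous_ge0 f -> continuous_ge0 g ->
  (forall x, 0 <= x -> `|f x - g x| <= 2 * C * E x) ->
  forall x, 0 <= x ->
    `|prim0 (fun t => a t * f t) x - prim0 (fun t => a t * g t) x| <= C * E x.
Proof.
move=> aK ca cf cg fg x x0.
have caf : continuous_ge0 (fun t => a t * f t) by exact: continuous_ge0M.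
have cag : continuous_ge0 (fun t => a t * g t) by exact: continuous_ge0M.
have C0 : 0 <= C.
  by have := fg 0 (lexx _); rewrite /E mulr0 expR0 mulr1 => /(le_trans (normr_ge0 _)); lra.
apply: (@derive_comparison R
  (fun x => prim0 (fun t => a t * f t) x - prim0 (fun t => a t * g t) x)
  (fun x => a x * f x - a x * g x)
  (fun x => C * E x) (fun x => C * ((2 * K) * E x))) => //.
- by apply: continuous_ge0B; exact: continuous_prim0.
- by move=> z _; apply: is_derive_continuous (is_derive_expRM _ _ _).
- by move=> z z0; apply: is_derive_sub; exact: is_derive_prim0.
- by move=> z _; exact: is_derive_expRM.
- by rewrite !prim00 subrr normr0 mulr_ge0// expR_ge0.
- move=> z z0; rewrite -mulrBr normrM.
  have := fg z (ltW z0); set d := `|f z - g z| => dE.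
  apply: (@le_trans _ _ (K * (2 * C * E z))).
    by apply: ler_pM => //; exact: normr_ge0.
  by rewrite le_eqVlt; apply/orP; left; apply/eqP; ring.
Qed.

Lemma picard_increment n x : 0 <= x ->
  `|(picard n.+1).1 x - (picard n).1 x| <= M * E x * 2^-1 ^+ n /\
  `|(picard n.+1).2 x - (picard n).2 x| <= M * E x * 2^-1 ^+ n.
Proof.
elim: n x => [|n IH] x x0.
  have z0 (a : R -> R) : prim0 (fun t => a t * cst 0 t) x = 0.
    by rewrite /prim0 /Rintegral; under eq_integral do rewrite mulr0; rewrite integral0.
  rewrite /= !z0 !subr0 !addr0 expr0 mulr1.
  have E1 : 1 <= E x.
    have := expR_ge1Dx ((2 * K) * x); have := mulr_ge0 (ltW K0) x0; rewrite /E; lra.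
  have ME := ler_wpM2l M0 E1; rewrite mulr1 in ME.
  by split; apply: le_trans ME; rewrite /M ?lerDl ?lerDr.
have [c1 c2] := continuous_picard n.
have [d1 d2] := continuous_picard n.+1.
have -> : M * E x * 2^-1 ^+ n.+1 = M * 2^-1 ^+ n.+1 * E x by ring.
have half z : M * E z * 2^-1 ^+ n = 2 * (M * 2^-1 ^+ n.+1) * E z.
  by rewrite exprS; field.
have cancel (c a b : R) : c + a - (c + b) = a - b by ring.
rewrite [picard n.+2]/= [picard n.+1 in X in X /\ _]/= [picard n.+1 in X in _ /\ X]/= !cancel.
have H k z : 0 <= z -> `|(if k then (picard n.+1).2 z else (picard n.+1).1 z) -
   (if k then (picard n).2 z else (picard n).1 z)| <= 2 * (M * 2^-1 ^+ n.+1) * E z.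
  by move=> z0; have [? ?] := IH z z0; rewrite -half; case: k.
split.
  by apply: prim0_contraction => // z z0; exact: (H true).
by apply: prim0_contraction => // z z0; exact: (H false).
Qed.

(** The convergence is uniform on bounded intervals of the half-line only; the
    second hypothesis extends the limit to the negative axis by its value at
    [0], which gives two-sided continuity at [0]. *)
Lemma uniform_limit_continuous (u : nat -> R -> R) (l : R -> R) :
  (forall n, continuous_ge0 (u n)) ->
  (forall x, l x = l (Num.max 0 x)) ->
  (forall n x, 0 <= x -> `|u n x - l x| <= 2 * (M * E x) * 2^-1 ^+ n) ->
  continuous_ge0 l.
Proof.
move=> cu lmax ul x x0.
suff : l z @[z --> x] --> l x by [].
apply/cvgrPdist_lt => e e0.
have e3 : 0 < e / 3 by lra.
have [n small] := half_expn_small (2 * (M * E (x + 1))) e3.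
have /cvgrPdist_lt/(_ (e / 3) ltac:(lra)) := cu n x x0 => -[d /= d0 Hd].
exists (Num.min d 1) => /=; first by rewrite lt_min d0 /=.
move=> z /=; rewrite lt_min => /andP[zd z1].
rewrite (lmax z); set z' := Num.max 0 z.
have z'0 : 0 <= z' by rewrite le_max lexx.
have zx : `|x - z'| <= `|x - z|.
  rewrite /z'; have [//|z0] := ltP 0 z; rewrite !ger0_norm; lra.
have z'1 : z' <= x + 1 by move: (le_lt_trans zx z1); rewrite ltr_norml; lra.
have A := ul n z' z'0; have B := ul n x x0; have C := Hd z' (le_lt_trans zx zd).
have mono (t : R) : t <= x + 1 -> 2 * (M * E t) * 2^-1 ^+ n <= 2 * (M * E (x + 1)) * 2^-1 ^+ n.
  move=> tx; apply: ler_wpM2r; first by rewrite exprn_ge0.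
  apply: ler_wpM2l => //; apply: ler_wpM2l => //.
  by rewrite ler_expR; apply: ler_wpM2l => //; have := K0; lra.
have A' := mono _ z'1; have B' := mono x ltac:(lra).
rewrite ltr_norml in C; rewrite !ler_norml in A B; rewrite ltr_norml; lra.
Qed.

(** Passage to the limit in [u n.+1 = b + prim0 (a * g n)]; by contraction the right-hand
    side converges at the same geometric rate as [g n]. *)
Lemma picard_limit_eq a b (f l c : R -> R) (u g : nat -> R -> R) :
  (forall n, u n.+1 = (fun x => b + prim0 (fun t => a t * g n t) x)) ->
  continuous_ge0 a -> (forall x, `|a x| <= K) ->
  (forall n, continuous_ge0 (g n)) -> continuous_ge0 c ->
  (forall n x, 0 <= x -> `|u n x - l x| <= 2 * (M * E x) * 2^-1 ^+ n) ->
  (forall n x, 0 <= x -> `|g n x - c x| <= 2 * (M * E x) * 2^-1 ^+ n) ->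
  forall x, 0 <= x -> l x = b + prim0 (fun t => a t * c t) x.
Proof.
move=> uS ca aK cg cc ul gc x x0.
apply/eqP; rewrite -subr_eq0 -normr_le0; apply/ler_addgt0Pr => e e0; rewrite add0r.
have [n small] := half_expn_small (2 * (M * E x)) e0.
have A := ul n.+1 x x0.
have B : `|prim0 (fun t => a t * g n t) x - prim0 (fun t => a t * c t) x| <=
    M * 2^-1 ^+ n * E x.
  apply: prim0_contraction => // z z0; apply: le_trans (gc n z z0) _.
  by rewrite le_eqVlt; apply/orP; left; apply/eqP; ring.
rewrite uS exprS in A.
move: A B small; rewrite !ler_norml => /andP[A1 A2] /andP[B1 B2] small.
apply/andP; split; lra.
Qed.

(** The solution is the limit of the Picard iterates, rewritten as a primitive so
    that it is differentiable. *)
Theorem linear_system_exists : exists y w : R -> R,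
  [/\ continuous_ge0 y /\ continuous_ge0 w, y 0 = y0, w 0 = w0,
   forall x : R, 0 < x -> is_derive x 1 y (p x * w x) &
   forall x : R, 0 < x -> is_derive x 1 w (r x * y x)].
Proof.
have lim (k : bool) : {l : R -> R & forall x n, 0 <= x ->
   `|(if k then (picard n).2 x else (picard n).1 x) - l x| <= 2 * (M * E x) * 2^-1 ^+ n}.
  apply: (@choice _ _ (fun x l => forall n, 0 <= x ->
   `|(if k then (picard n).2 x else (picard n).1 x) - l| <= 2 * (M * E x) * 2^-1 ^+ n)).
  move=> x; have [x0|x0] := leP 0 x; last first.
    by exists 0 => n x0'; exfalso; lra.
  have [] := @geometric_increments_limit R
    (fun n => if k then (picard n).2 x else (picard n).1 x) (M * E x).
    by move=> n; have [? ?] := @picard_increment n x x0; case: k.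
  by move=> l H; exists l.
have [ly Hy] := lim false; have [lw Hw] := lim true.
pose y x := ly (Num.max 0 x); pose w x := lw (Num.max 0 x).
have max0 (x : R) : 0 <= x -> Num.max 0 x = x by move=> /max_idPr.
have yH n x : 0 <= x -> `|(picard n).1 x - y x| <= 2 * (M * E x) * 2^-1 ^+ n.
  by move=> x0; rewrite /y max0//; exact: Hy.
have wH n x : 0 <= x -> `|(picard n).2 x - w x| <= 2 * (M * E x) * 2^-1 ^+ n.
  by move=> x0; rewrite /w max0//; exact: Hw.
have maxx x : Num.max 0 (Num.max 0 x) = Num.max 0 x :> R.
  by apply: max0; rewrite le_max lexx.
have cy : continuous_ge0 y.
  apply: (@uniform_limit_continuous (fun n => (picard n).1)) => //.
    by move=> n; have [] := continuous_picard n.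
  by move=> x; rewrite /y maxx.
have cw : continuous_ge0 w.
  apply: (@uniform_limit_continuous (fun n => (picard n).2)) => //.
    by move=> n; have [] := continuous_picard n.
  by move=> x; rewrite /w maxx.
have yE : forall x, 0 <= x -> y x = y0 + prim0 (fun t => p t * w t) x.
  apply: (@picard_limit_eq p y0 y y w (fun n => (picard n).1) (fun n => (picard n).2)) => //.
  by move=> n; have [] := continuous_picard n.
have wE : forall x, 0 <= x -> w x = w0 + prim0 (fun t => r t * y t) x.
  apply: (@picard_limit_eq r w0 y w y (fun n => (picard n).2) (fun n => (picard n).1)) => //.
  by move=> n; have [] := continuous_picard n.
have cpw : continuous_ge0 (fun t => p t * w t) by exact: continuous_ge0M.
have cry : continuous_ge0 (fun t => r t * y t) by exact: continuous_ge0M.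
exists (fun x => y0 + prim0 (fun t => p t * w t) x),
       (fun x => w0 + prim0 (fun t => r t * y t) x); split.
- by split; apply: continuous_ge0D; [exact: continuous_ge0_cst|exact: continuous_prim0|
    exact: continuous_ge0_cst|exact: continuous_prim0].
- by rewrite prim00 addr0.
- by rewrite prim00 addr0.
- move=> x x0; rewrite -wE ?ltW//; rewrite -[X in is_derive _ _ _ X]add0r.
  exact: (is_derive_add (is_derive_cst _ _ _) (is_derive_prim0 cpw x0)).
- move=> x x0; rewrite -yE ?ltW//; rewrite -[X in is_derive _ _ _ X]add0r.
  exact: (is_derive_add (is_derive_cst _ _ _) (is_derive_prim0 cry x0)).
Qed.

End PicardIteration.

(** * Solutions of the equation: existence, energy, uniqueness, monodromy *)

Section Solutions.
Context {R : realType}.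
Notation mu := (@lebesgue_measure R).
Implicit Types (f g y v gamma : R -> R) (s t : R).
Local Notation T := (2 * pi : R).

Lemma period_gt0 : 0 < T. Proof. by rewrite mulr_gt0// pi_gt0. Qed.

(** With [G] a primitive of [g], the function [- f * expR (- c * G)] has a
    nonnegative derivative almost everywhere. *)
Lemma gronwall_ae f g c s t : s <= t -> abs_continuous_on s t f ->
  mu.-integrable `[s, t] (EFin \o g) ->
  {ae mu, forall x : R, s <= x -> x <= t ->
     exists2 d : R, is_derive x 1 f d & d <= c * g x * f x} ->
  f t <= f s * expR (c * \int[mu]_(x in `[s, t]) g x).
Proof.
move=> st acf intg aef.
have [G [acG aeG Gs <-]] := L1_primitive st intg.
have H : - f s * expR (- c * G s) <= - f t * expR (- c * G t).
  apply: (@abs_continuous_ae_nondecreasing R (fun x => - f x * expR (- c * G x))) => //.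
    apply: abs_continuousM; first exact: abs_continuousN.
    apply: abs_continuous_expR; apply: abs_continuousM => //.
    exact: abs_continuous_cst.
  apply: (ae_imp (ae_and aef aeG)) => x [fx Gx] sx xt.
  have [d fd dle] := fx (ltW sx) (ltW xt).
  exists (- d * expR (- c * G x) + - f x * (- c * g x * expR (- c * G x))).
    exact: (is_derive_mul (is_derive_opp fd)
      (is_derive_exp (is_derive_scale _ (Gx (ltW sx) (ltW xt))))).
  have -> : - d * expR (- c * G x) + - f x * (- c * g x * expR (- c * G x)) =
    (c * g x * f x - d) * expR (- c * G x) by ring.
  by rewrite mulr_ge0 ?expR_ge0// subr_ge0.
move: H; rewrite Gs mulr0 expR0 mulr1 mulNr lerN2 !mulNr => H.
have := ler_wpM2r (expR_ge0 (c * G t)) H.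
by rewrite -mulrA -expRD addNr expR0 mulr1.
Qed.

Lemma gronwall_ae_ge f g c s t : s <= t -> abs_continuous_on s t f ->
  mu.-integrable `[s, t] (EFin \o g) ->
  {ae mu, forall x : R, s <= x -> x <= t ->
     exists2 d : R, is_derive x 1 f d & c * g x * f x <= d} ->
  f s * expR (c * \int[mu]_(x in `[s, t]) g x) <= f t.
Proof.
move=> st acf intg aef; rewrite -lerN2 -mulNr.
apply: (@gronwall_ae (fun x => - f x)) => //; first exact: abs_continuousN.
apply: (ae_imp aef) => x fx sx xt; have [d fd dge] := fx sx xt.
by exists (- d); [exact: is_derive_opp|rewrite mulrN lerN2].
Qed.

Lemma abs_continuous_C1 f f' t : 0 <= t -> continuous_ge0 f -> continuous_ge0 f' ->
  (forall x : R, 0 < x -> is_derive x 1 f (f' x)) -> abs_continuous_on 0 t f.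
Proof.
move=> t0 cf cf' df.
have cn : {within `[0, t], continuous (fun x => `|f' x|)}.
  apply: continuous_in_subspaceT => x; rewrite inE/= in_itv/= => /andP[x0 _].
  by apply: cvg_norm; exact: cf'.
have [c _ fc] := EVT_max t0 cn.
apply: (@abs_continuous_lipschitz _ `|f' c|) => // u w u0 uw wt.
have df' x : x \in `]u, w[ -> is_derive x 1 f (f' x).
  by rewrite in_itv/= => /andP[ux _]; apply: df; apply: le_lt_trans ux.
have cuw : {within `[u, w], continuous f}.
  apply: continuous_in_subspaceT => x; rewrite inE/= in_itv/= => /andP[x0 _].
  by apply: cf; exact: le_trans x0.
have [z] := MVT_segment uw df' cuw; rewrite in_itv/= => /andP[uz zw] ->.
rewrite normrM (ger0_norm (_ : 0 <= w - u)) ?subr_ge0//; apply: ler_wpM2r; first lra.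
by apply: fc; rewrite in_itv/=; apply/andP; split; lra.
Qed.

(** With [G] a primitive of [gamma], the substitution [v = expR (- G) * w] turns
    the system into [y' = expR (- G) * w], [w' = - expR G * y], in which
    [gamma] occurs only through the continuous function [G]. *)
Lemma solution_exists gamma a b : mu.-integrable `[0, T] (EFin \o gamma) ->
  exists y v, [/\ solution gamma y v, y 0 = a & v 0 = b].
Proof.
move=> intg; have T0 := ltW period_gt0.
have [G [acG aeG G0 _]] := L1_primitive T0 intg.
have [B B0 GB] := abs_continuous_bounded acG.
pose Gc x := G (clamp 0 T x).
have cGc := abs_continuous_clamp T0 acG.
have GcB x : `|Gc x| <= B by apply: GB; rewrite ?clamp_ge ?clamp_le.
pose p x := expR (- Gc x); pose r x := - expR (Gc x).
have cexp (h : R -> R) : continuous h -> continuous_ge0 (fun x => expR (h x)).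
  by move=> ch x _; apply: (@cvg_comp _ _ _ h expR _ (nbhs (h x)));
    [exact: ch|exact: continuous_expR].
have cp : continuous_ge0 p.
  by apply: cexp => x; apply: (@continuousN _ _ _ Gc); exact: cGc.
have cr : continuous_ge0 r.
  by move=> x x0; apply: continuousN; apply: (cexp Gc).
have pB x : `|p x| <= expR B.
  rewrite ger0_norm ?expR_ge0// ler_expR; have := GcB x; rewrite ler_norml; lra.
have rB x : `|r x| <= expR B.
  rewrite normrN ger0_norm ?expR_ge0// ler_expR; have := GcB x; rewrite ler_norml; lra.
have [y [w [[cy cw] y0 w0 dy dw]]] := linear_system_exists a b cp cr (expR_gt0 B) pB rB.
exists y, (fun x => expR (- G x) * w x).
have acy : abs_continuous_on 0 T y.
  by apply: (abs_continuous_C1 T0 cy _ dy); exact: continuous_ge0M.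
have acw : abs_continuous_on 0 T w.
  by apply: (abs_continuous_C1 T0 cw _ dw); exact: continuous_ge0M.
split => //; last by rewrite G0 oppr0 expR0 mul1r.
split => //.
- apply: abs_continuousM => //; apply: abs_continuous_expR; exact: abs_continuousN.
- apply: (ae_imp (ae_neq 0)) => x /eqP x0; rewrite in_itv/= => /andP[x0' xT].
  have xp : 0 < x by rewrite lt_neqAle eq_sym x0.
  by have := dy x xp; rewrite /p /Gc clamp_id.
- apply: (ae_imp (ae_and (ae_neq 0) aeG)) => x [/eqP x0 Gx].
  rewrite in_itv/= => /andP[x0' xT].
  have xp : 0 < x by rewrite lt_neqAle eq_sym x0.
  apply: is_derive_congr.
    exact: (is_derive_mul (is_derive_exp (is_derive_opp (Gx x0' xT))) (dw x xp)).
  rewrite /r /Gc clamp_id//.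
  have : expR (- G x) * expR (G x) = 1 by rewrite -expRD addNr expR0.
  set e := expR (- G x); set e' := expR (G x) => ee.
  have -> : - gamma x * e * w x + e * (- e' * y x) = - gamma x * (e * w x) - (e * e') * y x by ring.
  by rewrite ee mul1r.
Qed.

Lemma solution_lin gamma c1 c2 y1 v1 y2 v2 : solution gamma y1 v1 ->
  solution gamma y2 v2 ->
  solution gamma (fun x => c1 * y1 x + c2 * y2 x) (fun x => c1 * v1 x + c2 * v2 x).
Proof.
move=> [ay1 av1 dy1 dv1] [ay2 av2 dy2 dv2].
have aclin f g : abs_continuous_on 0 T f -> abs_continuous_on 0 T g ->
    abs_continuous_on 0 T (fun x => c1 * f x + c2 * g x).
  by move=> af ag; apply: abs_continuousD; apply: abs_continuousM => //;
    exact: abs_continuous_cst.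
split; [exact: aclin|exact: aclin| |].
- apply: (ae_imp (ae_and dy1 dy2)) => x [d1 d2] xT.
  exact: (is_derive_add (is_derive_scale c1 (d1 xT)) (is_derive_scale c2 (d2 xT))).
- apply: (ae_imp (ae_and dv1 dv2)) => x [d1 d2] xT.
  apply: is_derive_congr.
    exact: (is_derive_add (is_derive_scale c1 (d1 xT)) (is_derive_scale c2 (d2 xT))).
  by ring.
Qed.

Definition energy y v x : R := y x ^+ 2 + v x ^+ 2.

(** Multiplying the equation by [2 * y'] leaves only the friction term. *)
Lemma solution_energy gamma y v : solution gamma y v ->
  abs_continuous_on 0 T (energy y v) /\
  {ae mu, forall x : R, 0 <= x -> x <= T ->
    is_derive x 1 (energy y v) (- 2 * gamma x * v x ^+ 2)}.
Proof.
move=> [acy acv dy dv]; split.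
  by apply: abs_continuousD; apply: abs_continuousM.
apply: (ae_imp (ae_and dy dv)) => x [d1 d2] x0 xT.
have xT' : x \in `[0, T] by rewrite in_itv/= x0.
apply: is_derive_congr.
  exact: (is_derive_add (is_derive_mul (d1 xT') (d1 xT')) (is_derive_mul (d2 xT') (d2 xT'))).
by ring.
Qed.

Lemma solution_energy_le gamma g y v t : solution gamma y v ->
  mu.-integrable `[0, T] (EFin \o g) ->
  (forall x, 0 <= g x) -> (forall x, - gamma x <= g x) -> 0 <= t -> t <= T ->
  energy y v t <= energy y v 0 * expR (2 * \int[mu]_(x in `[0, T]) g x).
Proof.
move=> sol intg g0 gg t0 tT; have [acE dE] := solution_energy sol.
have subT : `[0, t] `<=` `[0, T].
  by apply: subset_itvl; rewrite bnd_simp.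
have intgt : mu.-integrable `[0, t] (EFin \o g) by apply: integrableS intg.
have mono : \int[mu]_(x in `[0, t]) g x <= \int[mu]_(x in `[0, T]) g x.
  apply: fine_le; try exact: integrable_fin_num.
  apply: ge0_subset_integral => //; first by have /integrableP[] := intg.
  by move=> x _; rewrite lee_fin.
apply: (@le_trans _ _ (energy y v 0 * expR (2 * \int[mu]_(x in `[0, t]) g x))); last first.
  apply: ler_wpM2l; first by rewrite addr_ge0 ?sqr_ge0.
  by rewrite ler_expR ler_pM2l.
apply: gronwall_ae => //; first exact: abs_continuous_subitv tT acE.
apply: (ae_imp dE) => x dx x0 xt.
eexists; first exact: dx x0 (le_trans xt tT).
rewrite /energy.
have := ler_wpM2r (sqr_ge0 (v x)) (gg x); have := mulr_ge0 (g0 x) (sqr_ge0 (y x)).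
lra.
Qed.

Lemma solution_energy_ge gamma g y v : solution gamma y v ->
  mu.-integrable `[0, T] (EFin \o g) ->
  (forall x, 0 <= g x) -> (forall x, gamma x <= g x) ->
  energy y v 0 * expR (- 2 * \int[mu]_(x in `[0, T]) g x) <= energy y v T.
Proof.
move=> sol intg g0 gg; have [acE dE] := solution_energy sol.
apply: gronwall_ae_ge => //; first exact: ltW period_gt0.
apply: (ae_imp dE) => x dx x0 xT.
eexists; first exact: dx.
rewrite /energy.
have := ler_wpM2r (sqr_ge0 (v x)) (gg x); have := mulr_ge0 (g0 x) (sqr_ge0 (y x)).
lra.
Qed.

Lemma funrpos_lb f x : f x <= f^\+ x.
Proof. by rewrite /funrpos le_max lexx. Qed.

Lemma funrneg_lb f x : - f x <= f^\- x.
Proof. by rewrite /funrneg le_max lexx. Qed.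

(** The difference of the two solutions starts with energy zero. *)
Lemma solution_unique gamma y1 v1 y2 v2 :
  mu.-integrable `[0, T] (EFin \o gamma) ->
  solution gamma y1 v1 -> solution gamma y2 v2 -> y1 0 = y2 0 -> v1 0 = v2 0 ->
  y1 T = y2 T /\ v1 T = v2 T.
Proof.
move=> intg s1 s2 y0 v0.
have intn : mu.-integrable `[0, T] (EFin \o gamma^\-) by exact: integrable_funrneg.
have := solution_energy_le (solution_lin 1 (-1) s1 s2) intn
  (@funrneg_ge0 _ _ gamma) (funrneg_lb gamma) (ltW period_gt0) (lexx _).
rewrite /energy y0 v0 !mul1r !mulN1r !subrr expr0n/= addr0 mul0r => E.
have y2' := sqr_ge0 (y1 T - y2 T); have v2' := sqr_ge0 (v1 T - v2 T).
have /eqP : (y1 T - y2 T) ^+ 2 = 0 by apply/eqP; rewrite eq_le y2'; lra.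
have /eqP : (v1 T - v2 T) ^+ 2 = 0 by apply/eqP; rewrite eq_le v2'; lra.
by rewrite !sqrf_eq0 !subr_eq0 => /eqP-> /eqP->.
Qed.

Lemma period_map_solution gamma y v : mu.-integrable `[0, T] (EFin \o gamma) ->
  solution gamma y v -> period_map gamma (state y v 0) = state y v T.
Proof.
move=> intg sol; rewrite /period_map; apply: xget_unique; first by exists y, v.
move=> _ [y' [v' [sol' s0 <-]]].
have y0 : y' 0 = y 0 by have /matrixP/(_ 0 0) := s0; rewrite !mxE.
have v0 : v' 0 = v 0 by have /matrixP/(_ 0 1) := s0; rewrite !mxE.
have [yT vT] := solution_unique intg sol' sol y0 v0.
by apply/matrixP => i j; rewrite !mxE yT vT.
Qed.

(** Row vectors are multiplied on the left of the monodromy matrix, so its rows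
    are the final states of the two fundamental solutions. *)
Lemma monodromy_rows gamma : mu.-integrable `[0, T] (EFin \o gamma) ->
  exists y1 v1 y2 v2, [/\ solution gamma y1 v1, solution gamma y2 v2,
    [/\ y1 0 = 1, v1 0 = 0, y2 0 = 0 & v2 0 = 1] &
    [/\ monodromy gamma 0 0 = y1 T, monodromy gamma 0 1 = v1 T,
        monodromy gamma 1 0 = y2 T & monodromy gamma 1 1 = v2 T]].
Proof.
move=> intg.
have [y1 [v1 [s1 y10 v10]]] := solution_exists 1 0 intg.
have [y2 [v2 [s2 y20 v20]]] := solution_exists 0 1 intg.
exists y1, v1, y2, v2; split => //.
have S1 : delta_mx 0 0 = state y1 v1 0.
  by apply/rowP => j; rewrite !mxE y10 v10 eqxx /= eq_sym; case: ifP.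
have S2 : delta_mx 0 1 = state y2 v2 0.
  apply/rowP => j; rewrite !mxE y20 v20 eqxx /=.
  by case: j => -[|[|//]] ?.
by split; rewrite /monodromy /lin1_mx !mxE ?S1 ?S2 period_map_solution// !mxE.
Qed.

(** Liouville's formula: the Wronskian [W] satisfies [W' = - gamma * W]. *)
Lemma wronskian gamma y1 v1 y2 v2 : mu.-integrable `[0, T] (EFin \o gamma) ->
  solution gamma y1 v1 -> solution gamma y2 v2 ->
  y1 T * v2 T - v1 T * y2 T = (y1 0 * v2 0 - v1 0 * y2 0) *
     expR (- 1 * \int[mu]_(x in `[0, T]) gamma x).
Proof.
move=> intg [ay1 av1 dy1 dv1] [ay2 av2 dy2 dv2].
pose W x := y1 x * v2 x - v1 x * y2 x.
have acW : abs_continuous_on 0 T W.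
  by apply: abs_continuousB; apply: abs_continuousM.
have dW : {ae mu, forall x : R, 0 <= x -> x <= T -> is_derive x 1 W (- 1 * gamma x * W x)}.
  apply: (ae_imp (ae_and (ae_and dy1 dv1) (ae_and dy2 dv2))) => x [[d1 d2] [d3 d4]] x0 xT.
  have xT' : x \in `[0, T] by rewrite in_itv/= x0.
  apply: is_derive_congr.
    exact: (is_derive_sub (is_derive_mul (d1 xT') (d4 xT')) (is_derive_mul (d2 xT') (d3 xT'))).
  by rewrite /W; ring.
apply/eqP; rewrite eq_le; apply/andP; split.
- apply: (@gronwall_ae W) => //; first exact: ltW period_gt0.
  by apply: (ae_imp dW) => x dx x0 xT; eexists; first exact: dx.
- apply: (@gronwall_ae_ge W) => //; first exact: ltW period_gt0.
  by apply: (ae_imp dW) => x dx x0 xT; eexists; first exact: dx.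
Qed.

End Solutions.

(** * Floquet multipliers and the a priori bounds *)

Section Multipliers.
Context {R : realType}.
Notation mu := (@lebesgue_measure R).
Implicit Types (gamma y v : R -> R) (M : 'M[R]_2).
Local Notation T := (2 * pi : R).
Local Notation normc := ComplexField.Normc.normc.
Local Notation toC := (real_complex R).

Lemma floquet_multipliers2 gamma (M := map_mx toC (monodromy gamma)) :
  exists z0 z1 : R[i], [/\ floquet_multipliers gamma = [:: z0; z1],
    z0 + z1 = toC (\tr (monodromy gamma)), z0 * z1 = toC (\det (monodromy gamma)),
    eigenvalue M z0 & eigenvalue M z1].
Proof.
rewrite /floquet_multipliers -/M; case: closed_field_poly_normal => rs /=.
rewrite (monicP (char_poly_monic M)) scale1r => E.
have srs : size rs = 2%N.
  by have := size_char_poly M; rewrite E size_prod_XsubC => -[].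
case: rs srs E => [|z0 [|z1 [|//]]] // _.
rewrite big_cons big_seq1 => E; exists z0, z1.
have E' : char_poly M = 'X^2 - (z0 + z1) *: 'X + (z0 * z1)%:P.
  by rewrite E polyCM -mul_polyC polyCD expr2; ring.
have root0 : root (char_poly M) z0 by rewrite E rootM root_XsubC eqxx.
have root1 : root (char_poly M) z1 by rewrite E rootM !root_XsubC eqxx orbT.
split => //; try by rewrite eigenvalue_root_char.
- have := char_poly_trace M isT.
  rewrite E' coefD coefB coefZ coefXn coefX coefC /= mulr1 add0r addr0.
  by rewrite trace_map_mx => /oppr_inj.
- have := char_poly_det M.
  rewrite E' coefD coefB coefZ coefXn coefX coefC /= mulr0 subr0 add0r.
  by rewrite det_map_mx sqrrN expr1n mul1r.
Qed.

Lemma ord2_cases (j : 'I_2) : j = 0 \/ j = 1.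
Proof. by case: j => -[|[|//]] ?; [left|right]; apply: val_inj. Qed.

Lemma sum_ord2 (V : zmodType) (F : 'I_2 -> V) : \sum_i F i = F 0 + F 1.
Proof. by rewrite big_ord_recl big_ord1; congr (_ + F _); apply: val_inj. Qed.

(** The real and imaginary parts [p], [q] of an eigenvector for [z = c + i s] are
    mapped to [c p - s q] and [s p + c q], whose squared norms add up to
    [c ^+ 2 + s ^+ 2] times those of [p] and [q]. This treats real and nonreal
    multipliers alike. *)
Lemma eigenvalue_real_parts M z : eigenvalue (map_mx toC M) z ->
  exists p1 p2 q1 q2 : R, 0 < p1 ^+ 2 + p2 ^+ 2 + (q1 ^+ 2 + q2 ^+ 2) /\
    (p1 * M 0 0 + p2 * M 1 0) ^+ 2 + (p1 * M 0 1 + p2 * M 1 1) ^+ 2 +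
    ((q1 * M 0 0 + q2 * M 1 0) ^+ 2 + (q1 * M 0 1 + q2 * M 1 1) ^+ 2) =
    normc z ^+ 2 * (p1 ^+ 2 + p2 ^+ 2 + (q1 ^+ 2 + q2 ^+ 2)).
Proof.
move=> /eigenvalueP[u uM u0].
have E0 : u 0 0 * toC (M 0 0) + u 0 1 * toC (M 1 0) = z * u 0 0.
  by have /matrixP/(_ 0 0) := uM; rewrite !mxE sum_ord2 !mxE.
have E1 : u 0 0 * toC (M 0 1) + u 0 1 * toC (M 1 1) = z * u 0 1.
  by have /matrixP/(_ 0 1) := uM; rewrite !mxE sum_ord2 !mxE.
have {}u0 : (u 0 0 != 0) || (u 0 1 != 0).
  rewrite -negb_and; apply: contra u0 => /andP[/eqP u00 /eqP u01].
  apply/eqP/matrixP => i j; rewrite (ord1 i) !mxE.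
  by case: (ord2_cases j) => ->.
move: E0 E1 u0; case: (u 0 0) => p1 q1; case: (u 0 1) => p2 q2; case: z {uM} => c s.
rewrite !eq_complex /= => -[E0r E0i] [E1r E1i] u0.
exists p1, p2, q1, q2; split.
  move: u0; rewrite !negb_and.
  have pos (x y z t : R) : x != 0 -> 0 < x ^+ 2 + y ^+ 2 + z ^+ 2 + t ^+ 2.
    move=> x0; have : 0 < x ^+ 2 by rewrite exprn_even_gt0.
    by have := sqr_ge0 y; have := sqr_ge0 z; have := sqr_ge0 t; lra.
  case/orP => /orP[] /pos H.
  - by have := H p2 q1 q2; lra.
  - by have := H q2 p1 p2; lra.
  - by have := H p1 q1 q2; lra.
  - by have := H q1 p1 p2; lra.
have -> : p1 * M 0 0 + p2 * M 1 0 = c * p1 - s * q1 by lra.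
have -> : p1 * M 0 1 + p2 * M 1 1 = c * p2 - s * q2 by lra.
have -> : q1 * M 0 0 + q2 * M 1 0 = c * q1 + s * p1 by lra.
have -> : q1 * M 0 1 + q2 * M 1 1 = c * q2 + s * p2 by lra.
rewrite sqr_sqrtr ?addr_ge0 ?sqr_ge0//; ring.
Qed.

Lemma det_ord2 (A : 'M[R]_2) : \det A = A 0 0 * A 1 1 - A 0 1 * A 1 0.
Proof.
rewrite (expand_det_row _ 0) sum_ord2 /cofactor !det_mx11 !mxE /= expr0 expr1.
have -> : lift 0 0 = 1 :> 'I_2 by apply: val_inj.
have -> : lift 1 0 = 0 :> 'I_2 by apply: val_inj.
by rewrite mul1r mulN1r mulrN.
Qed.

Section Class.
Variables (a b : R) (gamma : R -> R).
Hypothesis gammaP : Gamma a b gamma.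

Lemma Gamma_integrable : mu.-integrable `[0, T] (EFin \o gamma).
Proof. by have [[_]] := gammaP. Qed.

Lemma Gamma_pos : \int[mu]_(x in `[0, T]) gamma^\+ x = a.
Proof. by have [_ E _] := gammaP; rewrite /Rintegral E. Qed.

Lemma Gamma_neg : \int[mu]_(x in `[0, T]) gamma^\- x = b.
Proof. by have [_ _ E] := gammaP; rewrite /Rintegral E. Qed.

Lemma Gamma_int : \int[mu]_(x in `[0, T]) gamma x = a - b.
Proof.
rewrite -Gamma_pos -Gamma_neg -RintegralB//.
- by congr (Rintegral _ _ _); rewrite -[LHS]funrposBneg.
- by apply: integrable_funrpos => //; exact: Gamma_integrable.
- by apply: integrable_funrneg => //; exact: Gamma_integrable.
Qed.

Let M := monodromy gamma.

Lemma monodromy_det : \det M = expR (b - a).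
Proof.
have [y1 [v1 [y2 [v2 [s1 s2 [i1 i2 i3 i4] [m1 m2 m3 m4]]]]]] :=
  monodromy_rows Gamma_integrable.
have := wronskian Gamma_integrable s1 s2.
rewrite i1 i2 i3 i4 mulr1 mul0r subr0 mul1r Gamma_int mulN1r opprB => <-.
by rewrite -m1 -m2 -m3 -m4 det_ord2.
Qed.

Lemma monodromy_energy (p q : R) :
  (p ^+ 2 + q ^+ 2) * expR (- 2 * a) <=
     (p * M 0 0 + q * M 1 0) ^+ 2 + (p * M 0 1 + q * M 1 1) ^+ 2 <=
  (p ^+ 2 + q ^+ 2) * expR (2 * b).
Proof.
have [y1 [v1 [y2 [v2 [s1 s2 [i1 i2 i3 i4] [-> -> -> ->]]]]]] :=
  monodromy_rows Gamma_integrable.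
have s := solution_lin p q s1 s2.
have intn : mu.-integrable `[0, T] (EFin \o gamma^\-).
  by apply: integrable_funrneg => //; exact: Gamma_integrable.
have intp : mu.-integrable `[0, T] (EFin \o gamma^\+).
  by apply: integrable_funrpos => //; exact: Gamma_integrable.
have := solution_energy_le s intn (@funrneg_ge0 _ _ gamma) (funrneg_lb gamma)
  (ltW period_gt0) (lexx _).
have := solution_energy_ge s intp (@funrpos_ge0 _ _ gamma) (funrpos_lb gamma).
rewrite Gamma_neg Gamma_pos /energy i1 i2 i3 i4 !mulr1 !mulr0 addr0 add0r.
by move=> -> ->.
Qed.

(** The energy of both parts of an eigenvector is multiplied by a factor between
    [expR (- 2 * a)] and [expR (2 * b)] over a period. *)
Lemma multiplier_bounds z : eigenvalue (map_mx toC M) z ->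
  expR (- a) <= normc z <= expR b.
Proof.
move=> /eigenvalue_real_parts[p1 [p2 [q1 [q2 [n0 E]]]]].
have /andP[A1 A2] := monodromy_energy p1 p2; have /andP[B1 B2] := monodromy_energy q1 q2.
set n := p1 ^+ 2 + p2 ^+ 2 + (q1 ^+ 2 + q2 ^+ 2) in n0 E.
have z0 : 0 <= normc z by case: (z) => ? ?; rewrite /= sqrtr_ge0.
have sq x : expR (2 * x) = expR x ^+ 2 by rewrite expr2 -expRD; congr expR; ring.
have {A1 B1} L : expR (- a) ^+ 2 * n <= normc z ^+ 2 * n.
  by rewrite -E -sq mulrC /n mulrDl mulrN -mulNr; apply: lerD.
have {A2 B2} U : normc z ^+ 2 * n <= expR b ^+ 2 * n.
  by rewrite -E -sq [leRHS]mulrC /n mulrDl; apply: lerD.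
move: L U; rewrite !ler_pM2r// !ler_pXn2r ?nnegrE ?expR_ge0//.
by move=> -> ->.
Qed.

End Class.
End Multipliers.

(** * Friction concentrated in two short kicks *)

Section Kick.
Context {R : realType}.
Notation mu := (@lebesgue_measure R).
Local Notation T := (2 * pi : R).
Local Notation c := (pi / 2 : R).
Variables (a b h : R).
Hypotheses (a0 : 0 <= a) (b0 : 0 <= b) (h0 : 0 < h) (h1 : h < 1).

(** The negative part acts near time [0], the positive part a quarter period of
    the free rotation later. The intervals are open on the left, so that [kick]
    vanishes at [0] as well as at [2 * pi] and agrees with its periodic
    extension on the whole closed period. *)
Definition kick (t : R) : R :=
  a / h * \1_`]c, c + h] t - b / h * \1_`]0, h] t.

Definition kicked (t : R) : R := kick (t - T * (Num.floor (t / T))%:~R).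

Lemma kick_out t : (t <= 0) || (c + h < t) -> kick t = 0.
Proof.
have c1 := pihalf_ge1 R; have := h1; have := h0 => h0' h1'.
move=> H; rewrite /kick !indicE.
have -> : (t \in [set` `]c, c + h]]) = false.
  by apply/negP; rewrite inE/= in_itv/= => /andP[? ?]; case/orP: H => ?; lra.
have -> : (t \in [set` `]0, h]]) = false.
  by apply/negP; rewrite inE/= in_itv/= => /andP[? ?]; case/orP: H => ?; lra.
by rewrite !mulr0 subrr.
Qed.

Lemma kicked_period t : kicked (t + T) = kicked t.
Proof.
have T0 : T != 0 by rewrite gt_eqF// period_gt0.
rewrite /kicked; have -> : (t + T) / T = t / T + 1 by rewrite mulrDl divff.
rewrite Num.Theory.floorDrz ?rpred1// floor1 intrD; congr kick; ring.
Qed.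

Lemma kickedE t : 0 <= t -> t <= T -> kicked t = kick t.
Proof.
move=> t0; have Tp := @period_gt0 R; rewrite le_eqVlt => /predU1P[->|tT].
  rewrite /kicked divff ?gt_eqF// floor1 mulr1 subrr kick_out ?lexx//.
  by rewrite kick_out//; apply/orP; right; have := pihalf_ge1 R; have := h1; lra.
rewrite /kicked (@Num.Theory.floor_def _ _ 0) ?mulr0 ?subr0//.
by rewrite add0r mulr0z divr_ge0 ?(ltW Tp)//= ltr_pdivrMr// mul1r.
Qed.

Lemma kick_fst t : 0 < t -> t <= h -> kick t = - (b / h).
Proof.
have c1 := pihalf_ge1 R; have := h1; have := h0 => h0' h1' t0 th.
rewrite /kick !indicE.
have -> : (t \in [set` `]c, c + h]]) = false.
  by apply/negP; rewrite inE/= in_itv/= => /andP[? ?]; lra.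
have -> : t \in [set` `]0, h]] by rewrite inE/= in_itv/= t0.
by rewrite mulr0 mulr1 sub0r.
Qed.

Lemma kick_mid t : h < t -> t <= c -> kick t = 0.
Proof.
have c1 := pihalf_ge1 R; have := h1; have := h0 => h0' h1' t0 th.
rewrite /kick !indicE.
have -> : (t \in [set` `]c, c + h]]) = false.
  by apply/negP; rewrite inE/= in_itv/= => /andP[? ?]; lra.
have -> : (t \in [set` `]0, h]]) = false.
  by apply/negP; rewrite inE/= in_itv/= => /andP[? ?]; lra.
by rewrite !mulr0 subrr.
Qed.

Lemma kick_snd t : c < t -> t <= c + h -> kick t = a / h.
Proof.
have c1 := pihalf_ge1 R; have := h1; have := h0 => h0' h1' t0 th.
rewrite /kick !indicE.
have -> : (t \in [set` `]0, h]]) = false.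
  by apply/negP; rewrite inE/= in_itv/= => /andP[? ?]; lra.
have -> : t \in [set` `]c, c + h]] by rewrite inE/= in_itv/= t0.
by rewrite mulr0 mulr1 subr0.
Qed.

Lemma kick_parts t : kick^\+ t = a / h * \1_`]c, c + h] t /\
  kick^\- t = b / h * \1_`]0, h] t.
Proof.
have c1 := pihalf_ge1 R; have := h1; have := h0 => h0' h1'.
have ah : 0 <= a / h by rewrite divr_ge0// ltW.
have bh : 0 <= b / h by rewrite divr_ge0// ltW.
rewrite /funrpos /funrneg /kick !indicE.
have [A|A] := boolP (t \in [set` `]c, c + h]]);
have [B|B] := boolP (t \in [set` `]0, h]]); rewrite ?mulr1 ?mulr0 ?subr0 ?sub0r
  ?opprK ?oppr0 ?subrr ?maxxx.
- by move: A B; rewrite !inE/= !in_itv/= => /andP[? ?] /andP[? ?]; lra.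
- by split; [apply/max_idPl|apply/max_idPr; rewrite oppr_le0].
- by split; [apply/max_idPr; rewrite oppr_le0|apply/max_idPl].
- by [].
Qed.

Lemma integral_scaled_indic k u w : 0 <= k -> 0 <= u -> u <= w -> w <= T ->
  (\int[mu]_(t in `[0%R, T]) (k * \1_`]u, w] t)%:E = (k * (w - u))%:E)%E.
Proof.
move=> k0 u0 uw wT.
under eq_integral do rewrite EFinM.
rewrite ge0_integralZl_EFin//; last first.
  by apply/measurable_realfun.measurable_EFinP; exact: measurable_realfun.measurable_indic.
rewrite integral_indic// EFinM setIidl; last first.
  move=> x /=; rewrite !in_itv/= => /andP[ux xw].
  by rewrite (le_trans u0 (ltW ux)) (le_trans xw wT).
congr (_ * _)%E; apply: etrans (lebesgue_measure_itv _) _.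
rewrite /= lte_fin; case: ltP => // wu.
by have -> : u = w by [apply/eqP; rewrite eq_le uw wu]; rewrite subrr.
Qed.

Lemma kicked_Gamma : Gamma a b kicked.
Proof.
have c1 := pihalf_ge1 R; have := h1; have := h0 => h0' h1'.
have ah : 0 <= a / h by rewrite divr_ge0// ltW.
have bh : 0 <= b / h by rewrite divr_ge0// ltW.
have kE : {in `[0, T]%classic, kick =1 kicked}.
  by move=> t; rewrite inE/= in_itv/= => /andP[t0 tT]; rewrite kickedE.
have hn : h != 0 by rewrite gt_eqF.
split.
- split; first exact: kicked_period.
  apply: (@eq_integrable _ _ _ mu _ _ (EFin \o kick)) => //.
    by move=> t tT; rewrite /= kE.
  apply: (@integrableS _ _ _ _ setT) => //.
  pose f1 : R -> R := \1_`]c, c + h]; pose f2 : R -> R := \1_`]0, h].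
  have -> : EFin \o kick = ((fun t => (a / h)%:E * (f1 t)%:E) \-
     (fun t => (b / h)%:E * (f2 t)%:E))%E.
    by apply/funext => t; rewrite /kick /= EFinB !EFinM.
  apply: integrableB => //; apply: integrableZl => //;
    exact: integrable_indic_itv.
- transitivity (\int[mu]_(t in `[0%R, T]) (a / h * \1_`]c, c + h] t)%:E)%E.
    apply: eq_integral => t tT; rewrite -(kick_parts t).1 /funrpos kE//.
  rewrite integral_scaled_indic//; [|lra..].
  by congr EFin; field.
- transitivity (\int[mu]_(t in `[0%R, T]) (b / h * \1_`]0, h] t)%:E)%E.
    apply: eq_integral => t tT; rewrite -(kick_parts t).2 /funrneg kE//.
  rewrite integral_scaled_indic//; [|lra..].
  by congr EFin; field.
Qed.

End Kick.

(** * The trace of the monodromy matrix under two kicks *)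

Section Trace.
Context {R : realType}.
Notation mu := (@lebesgue_measure R).
Local Notation T := (2 * pi : R).
Local Notation c := (pi / 2 : R).

(** The integrating factor is [expR (k * (x - s))], which is at most
    [expR (`|k| * (t - s))] on the interval. *)
Lemma ae_relaxation (u : R -> R) k D s t : s <= t -> 0 <= D ->
  abs_continuous_on s t u ->
  {ae mu, forall x : R, s < x -> x < t ->
     exists2 d : R, is_derive x 1 u d & - k * u x - D <= d} ->
  expR (- (k * (t - s))) * (u s - D * expR (`|k| * (t - s)) * (t - s)) <= u t.
Proof.
move=> st D0 acu aeu; set L := D * expR (`|k| * (t - s)).
have H : u s * expR (k * (s - s)) + L * s <= u t * expR (k * (t - s)) + L * t.
  apply: (@abs_continuous_ae_nondecreasing R (fun x => u x * expR (k * (x - s)) + L * x)) => //.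
    have accst r : abs_continuous_on s t (fun _ : R => r) by exact: abs_continuous_cst.
    have acid : abs_continuous_on s t (fun x : R => x) by exact: abs_continuous_id.
    apply: abs_continuousD; apply: abs_continuousM => //.
    apply: abs_continuous_expR; apply: abs_continuousM => //.
    exact: abs_continuousB.
  apply: (ae_imp aeu) => x ux sx xt; have [d du dge] := ux sx xt.
  exists ((d + k * u x) * expR (k * (x - s)) + L); last first.
    have e0 := expR_ge0 (k * (x - s)).
    have kk : k * (x - s) <= `|k| * (t - s).
      apply: (@le_trans _ _ (`|k| * (x - s))); first by apply: ler_wpM2r; [lra|exact: ler_norm].
      by apply: ler_wpM2l => //; lra.
    have A : D * expR (k * (x - s)) <= L by apply: ler_wpM2l; rewrite ?ler_expR.
    have B : - D <= d + k * u x by lra.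
    by have := ler_wpM2r e0 B; lra.
  have dxs : is_derive x 1 (fun z => k * (z - s)) k.
    apply: (is_derive_congr (is_derive_scale k
      (is_derive_sub (is_derive_id x 1) (is_derive_cst s x 1)))).
    by rewrite subr0 mulr1.
  apply: (is_derive_congr (is_derive_add (is_derive_mul du (is_derive_exp dxs))
    (is_derive_scale L (is_derive_id x 1)))).
  by ring.
rewrite subrr mulr0 expR0 mulr1 in H.
have := ler_wpM2l (expR_ge0 (- (k * (t - s)))) (_ : u s - L * (t - s) <= u t * expR (k * (t - s))).
rewrite mulrCA -expRD addNr expR0 mulr1; apply; lra.
Qed.

Lemma sin_le_id (x : R) : 0 <= x -> `|sin x| <= x.
Proof.
apply: (@derive_comparison R sin cos id (cst 1)).
- by move=> z _; exact: continuous_sin.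
- by move=> z _; exact: cvg_id.
- by rewrite sin0 normr0.
- by move=> z _; rewrite ler_norml cos_geN1 cos_le1.
Qed.

Lemma normr_le_sqr (x C : R) : 0 <= C -> x ^+ 2 <= C ^+ 2 -> `|x| <= C.
Proof.
move=> C0; rewrite -(@real_normK _ x) ?num_real// => H.
by rewrite -(@ler_pXn2r _ 2) ?nnegrE.
Qed.

Lemma normrM_le (x y A B : R) : `|x| <= A -> `|y| <= B -> `|x * y| <= A * B.
Proof. by move=> xA yB; rewrite normrM; apply: ler_pM. Qed.

Section Kicked.
Variables (a b h : R).
Hypotheses (a0 : 0 <= a) (b0 : 0 <= b) (h0 : 0 < h) (h1 : h < 1).
Variables (y v : R -> R).
Hypothesis sol : solution (kicked a b h) y v.
Hypothesis unit_energy : energy y v 0 = 1.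

Let C := expR b.
(* Coordinates that rotate with the free motion: they are constant where the
   friction vanishes and coincide with (y, v) at both ends of the period. *)
Let p t := y t * cos t - v t * sin t.
Let q t := y t * sin t + v t * cos t.

Let kG : Gamma a b (kicked a b h). Proof. exact: kicked_Gamma. Qed.

Let T0 : 0 < T := period_gt0.
Let C0 : 0 <= C. Proof. exact: expR_ge0. Qed.

Lemma pq_energy t : p t ^+ 2 + q t ^+ 2 = energy y v t.
Proof.
have := cos2Dsin2 t; rewrite /p /q /energy => E.
transitivity ((y t ^+ 2 + v t ^+ 2) * (cos t ^+ 2 + sin t ^+ 2)); first by ring.
by rewrite E mulr1.
Qed.

Lemma kicked_energy t : 0 <= t -> t <= T -> energy y v t <= C ^+ 2.
Proof.
move=> t0 tT.
have intn : mu.-integrable `[0, T] (EFin \o (kicked a b h)^\-).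
  by apply: integrable_funrneg => //; exact: Gamma_integrable kG.
have := solution_energy_le sol intn (@funrneg_ge0 _ _ _) (funrneg_lb _) t0 tT.
rewrite (Gamma_neg kG) unit_energy mul1r => /le_trans; apply.
by rewrite /C expr2 -expRD ler_expR; lra.
Qed.

Lemma kicked_bounds t : 0 <= t -> t <= T ->
  [/\ `|p t| <= C, `|q t| <= C & `|v t| <= C].
Proof.
move=> t0 tT; have E := kicked_energy t0 tT; have E' := pq_energy t.
have p2 := sqr_ge0 (p t); have q2 := sqr_ge0 (q t).
have y2 := sqr_ge0 (y t); have v2 := sqr_ge0 (v t).
have CC := C0.
by split; apply: normr_le_sqr => //; move: E E'; rewrite /energy; lra.
Qed.

Lemma vE t : v t = q t * cos t - p t * sin t.
Proof.
have := cos2Dsin2 t; rewrite /p /q => E.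
transitivity (v t * (cos t ^+ 2 + sin t ^+ 2)); first by rewrite E mulr1.
by ring.
Qed.

Lemma pq_abs_continuous : abs_continuous_on 0 T p /\ abs_continuous_on 0 T q.
Proof.
have [acy acv _ _] := sol.
have acsin : abs_continuous_on 0 T sin.
  apply: (@abs_continuous_C1 R sin cos) => //; first exact: ltW.
  - by move=> z _; exact: continuous_sin.
  - by move=> z _; exact: continuous_cos.
have accos : abs_continuous_on 0 T cos.
  apply: (@abs_continuous_C1 R cos (fun z => - sin z)) => //; first exact: ltW.
  - by move=> z _; exact: continuous_cos.
  - by move=> z _; apply: continuousN; exact: continuous_sin.
by split; [apply: abs_continuousB|apply: abs_continuousD]; apply: abs_continuousM.
Qed.

Lemma pq_derive : {ae mu, forall x : R, 0 < x -> x <= T ->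
  is_derive x 1 p (kick a b h x * v x * sin x) /\
  is_derive x 1 q (- (kick a b h x * v x * cos x))}.
Proof.
have [_ _ dy dv] := sol.
apply: (ae_imp (ae_and dy dv)) => x [dyx dvx] x0 xT.
have xT' : x \in `[0, T] by rewrite in_itv/= ltW.
have ds := is_derive_sin x; have dc := is_derive_cos x.
rewrite -(kickedE a b h0 h1 (ltW x0) xT); split.
- apply: (is_derive_congr (is_derive_sub (is_derive_mul (dyx xT') dc)
    (is_derive_mul (dvx xT') ds))).
  by ring.
- apply: (is_derive_congr (is_derive_add (is_derive_mul (dyx xT') ds)
    (is_derive_mul (dvx xT') dc))).
  by ring.
Qed.

Lemma pq_relaxation (sel : bool) k D s t (u := if sel then q else p) :
  0 <= s -> s <= t -> t <= T -> 0 <= D ->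
  (forall x, s < x -> x < t -> - k * u x - D <=
     if sel then - (kick a b h x * v x * cos x) else kick a b h x * v x * sin x) ->
  expR (- (k * (t - s))) * (u s - D * expR (`|k| * (t - s)) * (t - s)) <= u t.
Proof.
move=> s0 st tT D0 H; have [acp acq] := pq_abs_continuous.
apply: ae_relaxation => //.
  by rewrite /u; case: sel {u H}; apply: abs_continuous_subitv s0 tT _.
apply: (ae_imp pq_derive) => x dx sx xt.
have [dp dq] := dx (le_lt_trans s0 sx) (le_trans (ltW xt) tT).
have := H x sx xt; rewrite /u; case: sel {u H} => Hx; eexists; try exact: Hx => //.
all: done.
Qed.

Lemma pq_const (sel : bool) s t (u := if sel then q else p) :
  0 <= s -> s <= t -> t <= T ->
  (forall x, s < x -> x < t -> kick a b h x = 0) -> u s <= u t.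
Proof.
move=> s0 st tT k0.
have := @pq_relaxation sel 0 0 s t s0 st tT (lexx _) _.
rewrite !(mul0r, oppr0, expR0, mul1r, addr0); apply => x sx xt.
by rewrite k0// !(mul0r, oppr0, addr0); case: (sel).
Qed.

Let c1 : 1 <= c. Proof. exact: pihalf_ge1. Qed.

Lemma late_const (sel : bool) (u := if sel then q else p) : u (c + h) <= u T.
Proof.
have := c1; have := h1; have := h0 => h0' h1' c1'.
apply: pq_const; try lra.
by move=> x cx _; rewrite kick_out ?cx ?orbT.
Qed.

Lemma middle_const (sel : bool) (u := if sel then q else p) : u h <= u c.
Proof.
have := c1; have := h1; have := h0 => h0' h1' c1'.
apply: pq_const; try lra.
by move=> x hx xc; rewrite kick_mid ?(ltW xc).
Qed.

Lemma norm_sin_le1 (x : R) : `|sin x| <= 1.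
Proof. by rewrite ler_norml sin_geN1 sin_le1. Qed.

Lemma norm_cos_le1 (x : R) : `|cos x| <= 1.
Proof. by rewrite ler_norml cos_geN1 cos_le1. Qed.

(** Since [v = q * cos - p * sin], the equation [q' = - gamma * v * cos] reads
    [q' = (b / h) * q] up to a bounded error on the first kick, where [sin] is
    at most [h]; on the second kick [cos] is at most [h] in absolute value, and
    [q'] is bounded. *)
Lemma q_lower : expR b * (q 0 - 2 * b * C * expR b * h) - a * C * h <= q T.
Proof.
have := c1; have := h1; have := h0; have := C0; have := T0; have := a0; have := b0.
move=> b0' a0' T0' C0' h0' h1' c1'.
have hn : h != 0 by rewrite gt_eqF.
have bh : 0 <= b / h by rewrite divr_ge0// ltW.
have ah : 0 <= a / h by rewrite divr_ge0// ltW.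
have C02 : 0 <= b * C by exact: mulr_ge0.
have first_kick : expR b * (q 0 - 2 * b * C * expR b * h) <= q h.
  have := @pq_relaxation true (- (b / h)) (2 * b * C) 0 h (lexx _) (ltW h0) _ _ _.
  rewrite subr0 mulNr divfK// !opprK normrN (ger0_norm bh) divfK//; apply; try lra.
  move=> x x0 xh; have [pC qC _] := @kicked_bounds x ltac:(lra) ltac:(lra).
  rewrite kick_fst ?(ltW xh)// vE.
  have sx : `|sin x| <= h by apply: le_trans (sin_le_id (ltW x0)) (ltW xh).
  have X1 := normrM_le (normrM_le qC (norm_sin_le1 x)) sx.
  have X2 := normrM_le (normrM_le pC (norm_cos_le1 x)) sx.
  have X : q x * sin x * sin x + p x * cos x * sin x <= 2 * C * h.
    move: X1 X2; rewrite !ler_norml; lra.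
  have {X1 X2} := ler_wpM2l bh X.
  have -> : b / h * (2 * C * h) = 2 * b * C by field.
  have := cos2Dsin2 x => E.
  have -> : - (- (b / h) * (q x * cos x - p x * sin x) * cos x) =
    b / h * q x * (cos x ^+ 2 + sin x ^+ 2)
      - b / h * (q x * sin x * sin x + p x * cos x * sin x) by ring.
  by rewrite E; lra.
have second_kick : q c - a * C * h <= q (c + h).
  have := @pq_relaxation true 0 (a * C) c (c + h) _ _ _ _ _.
  have -> : c + h - c = h by ring.
  rewrite !(mul0r, oppr0, expR0, mul1r, mulr1, addr0, normr0).
  apply; try lra; first exact: mulr_ge0.
  move=> x cx xh; have [_ _ vC] := @kicked_bounds x ltac:(lra) ltac:(lra).
  rewrite kick_snd ?(ltW xh)// mul0r sub0r.
  have sx : `|cos x| <= h.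
    rewrite -[x](subrK c) cosDpihalf normrN.
    by apply: le_trans (sin_le_id (_ : 0 <= x - c)) _; lra.
  have := normrM_le vC sx; rewrite ler_norml => /andP[_ X].
  have := ler_wpM2l ah X.
  have -> : a / h * (C * h) = a * C by field.
  by rewrite mulrA; lra.
have := middle_const true; have := late_const true => /=; lra.
Qed.

(** The roles of the kicks are exchanged: [p' = gamma * v * sin] is bounded on the
    first kick and equals [- (a / h) * p] up to a bounded error on the second. *)
Lemma p_lower : expR (- a) * (p 0 - b * C * h - 2 * a * C * expR a * h) <= p T.
Proof.
have := c1; have := h1; have := h0; have := C0; have := T0; have := a0; have := b0.
move=> b0' a0' T0' C0' h0' h1' c1'.
have hn : h != 0 by rewrite gt_eqF.
have bh : 0 <= b / h by rewrite divr_ge0// ltW.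
have ah : 0 <= a / h by rewrite divr_ge0// ltW.
have C02 : 0 <= a * C by exact: mulr_ge0.
have first_kick : p 0 - b * C * h <= p h.
  have := @pq_relaxation false 0 (b * C) 0 h (lexx _) (ltW h0) _ _ _.
  rewrite !(mul0r, oppr0, expR0, mul1r, mulr1, addr0, normr0).
  apply; try lra; first exact: mulr_ge0.
  move=> x x0 xh; have [_ _ vC] := @kicked_bounds x ltac:(lra) ltac:(lra).
  rewrite kick_fst ?(ltW xh)// mul0r sub0r.
  have sx : `|sin x| <= h by apply: le_trans (sin_le_id (ltW x0)) (ltW xh).
  have := normrM_le vC sx; rewrite ler_norml => /andP[_ X].
  have := ler_wpM2l bh X.
  have -> : b / h * (C * h) = b * C by field.
  by rewrite -mulrA mulNr; lra.
have second_kick : expR (- a) * (p c - 2 * a * C * expR a * h) <= p (c + h).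
  have := @pq_relaxation false (a / h) (2 * a * C) c (c + h) _ _ _ _ _.
  have -> : c + h - c = h by ring.
  rewrite (ger0_norm ah) divfK//.
  apply; try lra.
  move=> x cx xh; have [pC qC _] := @kicked_bounds x ltac:(lra) ltac:(lra).
  rewrite kick_snd ?(ltW xh)// vE.
  have sx : `|cos x| <= h.
    rewrite -[x](subrK c) cosDpihalf normrN.
    by apply: le_trans (sin_le_id (_ : 0 <= x - c)) _; lra.
  have X1 := normrM_le (normrM_le pC (norm_cos_le1 x)) sx.
  have X2 := normrM_le (normrM_le qC (norm_sin_le1 x)) sx.
  have X : - (p x * cos x * cos x + q x * sin x * cos x) <= 2 * C * h.
    move: X1 X2; rewrite !ler_norml; lra.
  have {X1 X2} := ler_wpM2l ah X.
  have -> : a / h * (2 * C * h) = 2 * a * C by field.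
  have := cos2Dsin2 x => E.
  have -> : a / h * (q x * cos x - p x * sin x) * sin x =
    - (a / h * p x * (cos x ^+ 2 + sin x ^+ 2))
      + a / h * (p x * cos x * cos x + q x * sin x * cos x) by ring.
  by rewrite E; lra.
have m := middle_const false; have l := late_const false.
apply: le_trans l; apply: le_trans second_kick.
apply: ler_wpM2l; first exact: expR_ge0.
rewrite /= in m; lra.
Qed.

Lemma pq0 : p 0 = y 0 /\ q 0 = v 0.
Proof. by rewrite /p /q sin0 cos0; split; ring. Qed.

Lemma pqT : p T = y T /\ q T = v T.
Proof.
have s2 : sin T = 0 by rewrite mulr_natl sin2pi.
have c2 : cos T = 1 by rewrite mulr_natl cos2pi.
by rewrite /p /q s2 c2; split; ring.
Qed.

Lemma kicked_solution_lower :
  expR b * (v 0 - 2 * b * C * expR b * h) - a * C * h <= v T /\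
  expR (- a) * (y 0 - b * C * h - 2 * a * C * expR a * h) <= y T.
Proof.
have [p0 q0] := pq0; have [pT qT] := pqT.
by split; [rewrite -q0 -qT; exact: q_lower|rewrite -p0 -pT; exact: p_lower].
Qed.

End Kicked.

(** As [h] tends to [0], the monodromy matrix tends to the diagonal matrix with
    entries [expR (- a)] and [expR b]; [p_lower] and [q_lower] bound the two
    diagonal entries from below. *)
Lemma kicked_trace (a b : R) : 0 <= a -> 0 <= b -> exists2 K, 0 <= K &
  forall h, 0 < h -> h < 1 ->
    expR b + expR (- a) - K * h <= \tr (monodromy (kicked a b h)).
Proof.
move=> a0 b0; have C0 := expR_ge0 b; have A0 := expR_ge0 a; have N0 := expR_ge0 (- a).
exists (expR b * (2 * b * expR b * expR b) + a * expR b +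
   expR (- a) * (b * expR b + 2 * a * expR b * expR a)).
  by rewrite !(addr_ge0, mulr_ge0).
move=> h h0 h1.
have [y1 [v1 [y2 [v2 [s1 s2 [i1 i2 i3 i4] [m1 m2 m3 m4]]]]]] :=
  monodromy_rows (Gamma_integrable (kicked_Gamma a0 b0 h0 h1)).
have e1 : energy y1 v1 0 = 1 by rewrite /energy i1 i2; ring.
have e2 : energy y2 v2 0 = 1 by rewrite /energy i3 i4; ring.
have [_ L1] := kicked_solution_lower a0 b0 h0 h1 s1 e1.
have [L2 _] := kicked_solution_lower a0 b0 h0 h1 s2 e2.
rewrite i1 in L1; rewrite i4 in L2.
rewrite /mxtrace sum_ord2 m1 m4.
lra.
Qed.

End Trace.

(** * Extremal multipliers and the supremum and infimum of the exponents *)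

Section Extremal.
Context {R : realType}.
Implicit Types (gamma : R -> R).
Local Notation T := (2 * pi : R).
Local Notation normc := ComplexField.Normc.normc.

Definition multiplier_modulus gamma k : R := normc (floquet_multipliers gamma)`_k.

Let m := multiplier_modulus.

Lemma multiplier_modulus_facts (a b : R) gamma : Gamma a b gamma ->
  [/\ expR (- a) <= m gamma 0 <= expR b, expR (- a) <= m gamma 1 <= expR b,
      m gamma 0 * m gamma 1 = expR (- a) * expR b &
      \tr (monodromy gamma) <= m gamma 0 + m gamma 1].
Proof.
move=> G; rewrite /m /multiplier_modulus.
have [z0 [z1 [-> tr det e0 e1]]] := floquet_multipliers2 gamma.
have normC (x : R) : normc (real_complex R x) = `|x|.
  by rewrite /= expr0n addr0 sqrtr_sqr.
split => /=; [exact: multiplier_bounds G _ e0|exact: multiplier_bounds G _ e1| |].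
  rewrite -ComplexField.Normc.normcM det (monodromy_det G) normC ger0_norm ?expR_ge0//.
  by rewrite -expRD addrC.
apply: le_trans (le_normcD _ _); rewrite tr normC; exact: ler_norm.
Qed.

Lemma mu_plusE gamma : 0 < m gamma 0 -> 0 < m gamma 1 ->
  mu_plus gamma = ln (Num.max (m gamma 0) (m gamma 1)) / T.
Proof.
move=> m0 m1; rewrite /mu_plus /lyapunov_exponent -/(m gamma 0) -/(m gamma 1).
have T0 : 0 < T^-1 by rewrite invr_gt0 period_gt0.
have [le|/ltW le] := leP (m gamma 0) (m gamma 1).
  by apply/max_idPr; rewrite ler_pM2r// ler_ln.
by apply/max_idPl; rewrite ler_pM2r// ler_ln.
Qed.

Lemma mu_minusE gamma : 0 < m gamma 0 -> 0 < m gamma 1 ->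
  mu_minus gamma = ln (Num.min (m gamma 0) (m gamma 1)) / T.
Proof.
move=> m0 m1; rewrite /mu_minus /lyapunov_exponent -/(m gamma 0) -/(m gamma 1).
have T0 : 0 < T^-1 by rewrite invr_gt0 period_gt0.
have [le|/ltW le] := leP (m gamma 0) (m gamma 1).
  by apply/min_idPl; rewrite ler_pM2r// ler_ln.
by apply/min_idPr; rewrite ler_pM2r// ler_ln.
Qed.

(** With the product [A * B] given, [(B - x) * (x - A) = x * (A + B - (x + x'))];
    so an almost maximal sum forces the larger factor [x] towards [A] or [B],
    and [x' <= x] excludes [A]. *)
Lemma root_separation (A B d x x' : R) : 0 < A -> 0 <= d -> x <= B -> A <= x' ->
  x' <= x -> x * x' = A * B -> A + B - d <= x + x' ->
  A * (B - x) ^+ 2 <= d * B ^+ 2 /\ x' - A <= B - x.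
Proof.
move=> A0 d0 xB Ax' x'x xx' sum.
have x0 : 0 < x by lra.
have Bx : 0 <= B - x by lra.
have d1 : (B - x) * (x - A) <= d * x.
  have -> : (B - x) * (x - A) = (A + B - x) * x - A * B by ring.
  by rewrite -xx' (mulrC x) -mulrBl ler_pM2r//; lra.
have d2 : A * (B - x) <= x * (x - A).
  have := ler_wpM2l (ltW x0) x'x; rewrite xx'; lra.
split.
  apply: (@le_trans _ _ (d * x ^+ 2)).
    have -> : A * (B - x) ^+ 2 = (B - x) * (A * (B - x)) by ring.
    apply: le_trans (ler_wpM2l Bx d2) _.
    have -> : (B - x) * (x * (x - A)) = (B - x) * (x - A) * x by ring.
    have -> : d * x ^+ 2 = d * x * x by ring.
    by apply: ler_wpM2r => //; exact: ltW.
  by apply: ler_wpM2l => //; rewrite ler_pXn2r ?nnegrE//; lra.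
rewrite -(ler_pM2l x0) mulrBr xx'.
have -> : A * B - x * A = A * (B - x) by ring.
by apply: ler_wpM2r => //; lra.
Qed.

(** The moduli have product [expR (- a) * expR b] by Liouville's formula and a sum
    close to [expR (- a) + expR b] by the trace estimate for two short kicks. *)
Lemma extremal_family (a b e : R) : 0 <= a -> 0 <= b -> 0 < e ->
  exists2 gamma, Gamma a b gamma &
    expR b - e <= Num.max (m gamma 0) (m gamma 1) /\
    Num.min (m gamma 0) (m gamma 1) <= expR (- a) + e.
Proof.
move=> a0 b0 e0; have [K K0 trK] := kicked_trace a0 b0.
set A := expR (- a); set B := expR b.
have A0 : 0 < A by exact: expR_gt0.
have B0 : 0 < B by exact: expR_gt0.
have K1 : 0 < K + 1 by lra.
have B2 : 0 < B ^+ 2 * (K + 1) by rewrite mulr_gt0// exprn_gt0.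
(* small enough for K * h * B ^+ 2 <= A * e ^+ 2, the bound on the gap that
   root_separation asks for; K + 1 avoids a division by zero *)
pose h := Num.min (2^-1) (e ^+ 2 * A / (B ^+ 2 * (K + 1))).
have h0 : 0 < h.
  by rewrite lt_min invr_gt0 ltr0n divr_gt0// mulr_gt0// exprn_gt0.
have h1 : h < 1 by rewrite gt_min; apply/orP; left; lra.
have hK : (K * h) * B ^+ 2 <= A * e ^+ 2.
  have : h <= e ^+ 2 * A / (B ^+ 2 * (K + 1)) by rewrite ge_min lexx orbT.
  rewrite ler_pdivlMr// => H.
  have := mulr_ge0 (ltW h0) (ltW (exprn_gt0 2 B0)); lra.
have G := kicked_Gamma a0 b0 h0 h1; exists (kicked a b h) => //.
have [/andP[L0 U0] /andP[L1 U1] P S] := multiplier_modulus_facts G.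
have {}S := le_trans (trK h h0 h1) S.
have close x x' : x <= B -> A <= x' -> x' <= x -> x * x' = A * B ->
    A + B - K * h <= x + x' -> B - e <= x /\ x' <= A + e.
  move=> xB Ax' x'x xx' sum.
  have [E1 E2] := root_separation A0 (mulr_ge0 K0 (ltW h0)) xB Ax' x'x xx' sum.
  have := le_trans E1 hK; rewrite ler_pM2l// ler_pXn2r ?nnegrE//; [|lra..].
  by split; lra.
have [le|/ltW le] := leP (m (kicked a b h) 0) (m (kicked a b h) 1).
  by apply: close => //; [rewrite mulrC|move: S; rewrite -/A -/B; lra].
by apply: close => //; move: S; rewrite -/A -/B; lra.
Qed.

End Extremal.

Unset Implicit Arguments.

Theorem proposition2p1 (R : realType) (a b : R) (ha : 0 <= a) (hb : 0 <= b) :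
  ereal_sup [set (mu_plus gamma)%:E | gamma in Gamma a b] = (b / (2 * pi))%:E
  /\ ereal_inf [set (mu_minus gamma)%:E | gamma in Gamma a b]
     = (- (a / (2 * pi)))%:E.
Proof.
have T0 : 0 < (2 * pi : R) by exact: period_gt0.
have Tn : (2 * pi : R) != 0 by rewrite gt_eqF.
split; apply/eqP; rewrite eq_le; apply/andP; split.
- apply: ge_ereal_sup => _ [gamma G <-]; rewrite lee_fin.
  have [/andP[L0 U0] /andP[L1 U1] _ _] := multiplier_modulus_facts G.
  have P0 := lt_le_trans (expR_gt0 _) L0; have P1 := lt_le_trans (expR_gt0 _) L1.
  rewrite mu_plusE// ler_pM2r ?invr_gt0// -[leRHS]expRK ler_ln ?posrE ?expR_gt0//.
    by rewrite ge_max U0.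
  by rewrite lt_max P0.
- apply/lee_addgt0Pr => e e0.
  have small : 0 < expR b - expR (b - e * (2 * pi)).
    by rewrite subr_gt0 ltr_expR ltrBlDr ltrDl mulr_gt0.
  have [gamma G [H _]] := extremal_family ha hb small.
  have [/andP[L0 U0] /andP[L1 U1] _ _] := multiplier_modulus_facts G.
  have P0 := lt_le_trans (expR_gt0 _) L0; have P1 := lt_le_trans (expR_gt0 _) L1.
  rewrite -leeBlDr// -EFinB.
  apply: le_trans (ereal_sup_ubound _); last by exists gamma.
  rewrite lee_fin mu_plusE// ler_pdivlMr// mulrBl divfK// -[leLHS]expRK.
  rewrite ler_ln ?posrE ?expR_gt0//; first by move: H; lra.
  by rewrite lt_max P0.
- apply/lee_subgt0Pr => e e0.
  have small : 0 < expR (- a + e * (2 * pi)) - expR (- a).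
    by rewrite subr_gt0 ltr_expR ltrDl mulr_gt0.
  have [gamma G [_ H]] := extremal_family ha hb small.
  have [/andP[L0 U0] /andP[L1 U1] _ _] := multiplier_modulus_facts G.
  have P0 := lt_le_trans (expR_gt0 _) L0; have P1 := lt_le_trans (expR_gt0 _) L1.
  rewrite leeBlDr// -EFinD.
  apply: le_trans (ereal_inf_lbound _) _; first by exists gamma.
  rewrite lee_fin mu_minusE// ler_pdivrMr// mulrDl mulNr divfK// -[leRHS]expRK.
  rewrite ler_ln ?posrE ?expR_gt0//; first by move: H; lra.
  by rewrite lt_min P0.
- apply: le_ereal_inf_tmp => _ [gamma G <-]; rewrite lee_fin.
  have [/andP[L0 U0] /andP[L1 U1] _ _] := multiplier_modulus_facts G.
  have P0 := lt_le_trans (expR_gt0 _) L0; have P1 := lt_le_trans (expR_gt0 _) L1.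
  rewrite mu_minusE// -mulNr ler_pM2r ?invr_gt0// -[leLHS]expRK ler_ln ?posrE ?expR_gt0//.
    by rewrite le_min L0.
  by rewrite lt_min P0.
Qed.
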